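(* Let $q$ be a prime power and $k$ a large enough constant. Let $N = q^k$ and identify $[N]$ with $\mathbb{F}_q^k$. Consider the 3-player function $D : [N]^3 \to \{0,1\}$, $$D(x,y,z) = \mathbb{1}[\langle x,y\rangle = \langle x,z\rangle = \langle y,z\rangle],$$ where $\langle x,y\rangle = \sum_{i=1}^k x_i y_i \in \mathbb{F}_q$. Then: (1) the randomized Number-On-Forehead communication complexity of $D$ (with public randomness) is $O(1)$; (2) the deterministic (and also the non-deterministic) Number-On-Forehead communication complexity of $D$ is $\Omega((\log N)^{1/2})$.
   Context: In the 3-party Number-On-Forehead (NOF) model, the input is $(x,y,z)$; player 1 sees $(y,z)$, player 2 sees $(x,z)$, player 3 sees $(x,y)$; players communicate by writing bits on a shared blackboard according to a protocol, and the output must equal $D(x,y,z)$. The deterministic complexity is the minimum worst-case number of bits of a deterministic protocol computing $D$ on all inputs; the randomized complexity with public randomness is the minimum worst-case number of bits of a protocol using shared random bits that outputs $D(x,y,z)$ with probability at least $2/3$ on every input; the non-deterministic complexity is the corresponding measure for non-deterministic protocols (certifying the 1-inputs). The implied constants in $O(\cdot)$ and $\Omega(\cdot)$ do not depend on $q$. *)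

(* Defs.v *)
From HB Require Import structures.
From mathcomp Require Import all_boot all_order all_algebra.
From mathcomp Require Import boolp reals exp.

Set Implicit Arguments.
Unset Strict Implicit.
Unset Printing Implicit Defensive.

Import Order.TTheory GRing.Theory Num.Theory.

Local Open Scope ring_scope.

(* A deterministic three-party number-on-forehead protocol: the transcript so
   far (the node) determines who writes the next bit, and that bit depends only
   on the two inputs which the speaker sees.  The first subtree is followed when
   the bit is 1, the second when it is 0. *)
Inductive nof_protocol (X Y Z : Type) : Type :=
| Output of bool
| Speak1 of (Y -> Z -> bool) & nof_protocol X Y Z & nof_protocol X Y Z
| Speak2 of (X -> Z -> bool) & nof_protocol X Y Z & nof_protocol X Y Z
| Speak3 of (X -> Y -> bool) & nof_protocol X Y Z & nof_protocol X Y Z.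

Fixpoint nof_run (X Y Z : Type) (P : nof_protocol X Y Z)
    (x : X) (y : Y) (z : Z) : bool :=
  match P with
  | Output b => b
  | Speak1 f P1 P0 => if f y z then nof_run P1 x y z else nof_run P0 x y z
  | Speak2 f P1 P0 => if f x z then nof_run P1 x y z else nof_run P0 x y z
  | Speak3 f P1 P0 => if f x y then nof_run P1 x y z else nof_run P0 x y z
  end.

Fixpoint nof_cost (X Y Z : Type) (P : nof_protocol X Y Z) : nat :=
  match P with
  | Output _ => 0
  | Speak1 _ P1 P0 | Speak2 _ P1 P0 | Speak3 _ P1 P0 =>
      (maxn (nof_cost P1) (nof_cost P0)).+1
  end.

Definition det_within (X Y Z : finType) (D : X -> Y -> Z -> bool) (c : nat) :
    Prop :=
  exists P : nof_protocol X Y Z,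
    (nof_cost P <= c)%N /\ forall x y z, nof_run P x y z = D x y z.

(* Public randomness: a uniformly random m-bit string, for an arbitrary m, is
   known to all players at no cost. *)
Definition rand_within (X Y Z : finType) (D : X -> Y -> Z -> bool) (c : nat) :
    Prop :=
  exists (m : nat) (P : m.-tuple bool -> nof_protocol X Y Z),
    (forall r, (nof_cost (P r) <= c)%N) /\
    forall x y z,
      2 / 3 <= #|[set r | nof_run (P r) x y z == D x y z]|%:R
               / #|{: m.-tuple bool}|%:R :> rat.

(* A witness of m bits is guessed and written on the blackboard, where all
   players see it and its bits count towards the cost; then a deterministic
   protocol is run.  The input is accepted iff some witness leads to
   acceptance. *)
Definition nondet_within (X Y Z : finType) (D : X -> Y -> Z -> bool) (c : nat) :
    Prop :=
  exists (m : nat) (P : m.-tuple bool -> nof_protocol X Y Z),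
    (forall w, (m + nof_cost (P w) <= c)%N) /\
    forall x y z, D x y z <-> exists w, nof_run (P w) x y z.

Section Existence.
Variables (X Y Z : finType) (D : X -> Y -> Z -> bool).

Lemma det_within_ex : exists c, `[< det_within D c >].
Proof.
pose build := fix build (s : seq Z) : nof_protocol X Y Z :=
  if s is z0 :: s' then
    Speak1 (fun _ z => z == z0)
      (Speak3 (fun x y => D x y z0) (Output X Y Z true) (Output X Y Z false))
      (build s')
  else Output X Y Z false.
have runE s x y z : z \in s -> nof_run (build s) x y z = D x y z.
  elim: s => //= z0 s IHs; rewrite inE.
  by case: eqP => [-> _|_ /= /IHs//]; case: (D x y z0).
exists (nof_cost (build (enum Z))); apply/asboolP; exists (build (enum Z)).
by split=> // x y z; rewrite runE ?mem_enum.
Qed.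

Lemma rand_within_ex : exists c, `[< rand_within D c >].
Proof.
have [c /asboolP [P [Pc PD]]] := det_within_ex.
exists c; apply/asboolP; exists 0%N, (fun=> P); split=> // x y z.
rewrite (_ : [set r | _] = setT); last by apply/setP=> r; rewrite !inE PD eqxx.
by rewrite cardsT card_tuple expn0.
Qed.

Lemma nondet_within_ex : exists c, `[< nondet_within D c >].
Proof.
have [c /asboolP [P [Pc PD]]] := det_within_ex.
exists c; apply/asboolP; exists 0%N, (fun=> P); split=> // x y z.
by split=> [Dxyz|[w]]; [exists [tuple]|]; rewrite PD.
Qed.

Definition det_cc : nat := ex_minn det_within_ex.
Definition rand_cc : nat := ex_minn rand_within_ex.
Definition nondet_cc : nat := ex_minn nondet_within_ex.

End Existence.

Definition dotp (F : finFieldType) (k : nat) (x y : 'rV[F]_k) : F :=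
  \sum_(i < k) x 0 i * y 0 i.

Definition eq_dotp (F : finFieldType) (k : nat) (x y z : 'rV[F]_k) : bool :=
  (dotp x y == dotp x z) && (dotp x z == dotp y z).

Definition prime_power (q : nat) : Prop :=
  exists p n : nat, [/\ prime p, (0 < n)%N & q = (p ^ n)%N].

Definition log2 (R : realType) (x : R) : R := ln x / ln 2.

(* Main.v *)
Require Import Defs.
From HB Require Import structures.
From mathcomp Require Import all_boot all_order all_algebra.
From mathcomp Require Import boolp reals exp.
From mathcomp Require Import zify ring lra.

(** Lower bound.  A non-deterministic protocol of cost [c] covers the ones of [D]
    by [2 ^ c] cylinder intersections, so one of them, [T], contains a fraction
    [2 ^ -c] of [D].  Choose a box [X * Y * Z] maximising
    [|T cap box| ^ n.+1 / |box| ^ n] with [n = O(c)]; its density is at least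
    [2 ^ -O(c ^ 2)].  Write [r x y] for the normalised number of [z] with
    [T x y z], and [s x z] for the normalised number of [y].  Maximality says that
    no subrectangle of size [rho] has [r]-density above [rho ^ -(1 / n.+1)], and
    that all degrees are at least [1 - 1 / n.+1].  The first fact bounds high
    moments of the codegrees [y, y' |-> \sum_x r x y * r x y']; as all moments of
    the centred codegrees are nonnegative, these are close to [1] in [L^p] for some
    [p = O(c)], and by Cauchy-Schwarz so are the mixed codegrees
    [y, z |-> \sum_x r x y * s x z].  Hence all but a fraction [2 ^ -p] of the pairs
    [(y, z)] have at least [2 ^ -O(c) * |X|] common neighbours [x].  By a
    second-moment count, [D] has density about [q ^ -2] on [X * {(y, z)}] for most
    [(y, z)], so at least a fraction [2 ^ -O(c)] of the pairs [(y, z)] is allowed by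
    the third cylinder, and [T] has density [2 ^ -O(c)] on the box.  As [T] is
    contained in [D], this density is at most [3 * q ^ -2], so [q] is at most
    [2 ^ O(c ^ 2)].

    Upper bound.  The three players compare two random one-bit hashes of the three
    scalar products. *)

Set Implicit Arguments.
Unset Strict Implicit.
Unset Printing Implicit Defensive.

Import Order.TTheory GRing.Theory Num.Theory.

Local Open Scope ring_scope.

Lemma eq_ler (R : numDomainType) (x y : R) : x = y -> x <= y.
Proof. by move=> ->. Qed.

(** * Weighted sums and weak-type bounds *)

Section Moments.
Variable R : realFieldType.

(** AM-GM for the number 1 together with [n] copies of [t]. *)
Lemma weighted_AGM (n : nat) (t : R) : 0 <= t ->
  n.+1%:R ^+ n.+1 * t ^+ n <= (1 + n%:R * t) ^+ n.+1.
Proof.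
move=> t0.
pose E (i : 'I_n.+1) : R := if i == ord0 then 1 else t.
have E0 : {in 'I_n.+1, forall i, 0 <= E i} by move=> i _; rewrite /E; case: ifP.
have [+ _] := leif_AGM E0.
rewrite card_ord !big_ord_recl /E eqxx /=.
rewrite prodr_const sumr_const card_ord mul1r -[t *+ n]mulr_natl expr_div_n.
by rewrite ler_pdivlMr ?exprn_gt0 ?ltr0Sn // mulrC.
Qed.

(** Passing from sets to weights costs no constant. Let S be the weighted sum, W the total weight
    and U the set where [g] exceeds the threshold m = n/(n+1) S/W. Then S - m W is at most G - m
    |U|, so the sum G of [g] over U is at least S/(n+1) (1 + n |U|/W), and AM-GM gives S^(n+1)
    (|U|/W)^n <= G^(n+1). *)
Lemma weighted_sum_bound (I : finType) (X : {set I}) (g w : I -> R) (B : R)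
    (n : nat) :
  0 <= B -> (forall x, 0 <= g x) -> (forall x, 0 <= w x <= 1) ->
  (forall U : {set I}, U \subset X ->
     (\sum_(x in U) g x) ^+ n.+1 <= B * #|U|%:R ^+ n) ->
  (\sum_(x in X) w x * g x) ^+ n.+1 <= B * (\sum_(x in X) w x) ^+ n.
Proof.
move=> B0 g0 w01 HU.
have w0 x : 0 <= w x by case/andP: (w01 x).
have w1 x : w x <= 1 by case/andP: (w01 x).
set S := \sum_(x in X) w x * g x; set W := \sum_(x in X) w x.
have W0 : 0 <= W by apply: sumr_ge0.
have S0 : 0 <= S by apply: sumr_ge0 => x _; apply: mulr_ge0.
have [S_le0|S_gt0] := leP S 0.
  have -> : S = 0 by apply/le_anti; rewrite S_le0 S0.
  by rewrite expr0n /= mulr_ge0 // exprn_ge0.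
have W_gt0 : 0 < W.
  rewrite lt_def W0 andbT; apply/eqP => W_eq0.
  have wx0 x : x \in X -> w x = 0.
    by apply: (psumr_eq0P (fun i _ => w0 i)).
  by move: S_gt0; rewrite /S big1 ?ltxx // => x xX; rewrite wx0 // mul0r.
pose m := n%:R / n.+1%:R * (S / W).
have m0 : 0 <= m by rewrite !mulr_ge0 // ?invr_ge0 // ltW.
pose U := [set x in X | m < g x].
have UX : U \subset X by apply/subsetP => x; rewrite inE => /andP[].
pose G := \sum_(x in U) g x.
have key : S - m * W <= G - m * #|U|%:R.
  have -> : S - m * W = \sum_(x in X) w x * (g x - m).
    by rewrite mulr_sumr -sumrB; apply: eq_bigr => x _; ring.
  have -> : G - m * #|U|%:R = \sum_(x in U) (g x - m).
    by rewrite sumrB sumr_const -[m *+ _]mulr_natr.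
  rewrite [leLHS](big_setID U) /= (setIidPr UX).
  rewrite -[leRHS]addr0; apply: lerD.
    apply: ler_sum => x; rewrite inE => /andP[_ /ltW mg].
    by rewrite ler_piMl ?subr_ge0.
  apply: sumr_le0 => x; rewrite !inE => /andP[+ xX]; rewrite xX /= -leNgt => gm.
  by rewrite mulr_ge0_le0 // subr_le0.
have nS : n.+1%:R != 0 :> R by rewrite pnatr_eq0.
have W_neq0 : W != 0 by rewrite gt_eqF.
have mW : m * W = S - S / n.+1%:R.
  have -> : m * W = n%:R / n.+1%:R * S by rewrite /m -mulrA mulfVK.
  have -> : n%:R = n.+1%:R - 1 :> R by rewrite -natr1 addrK.
  by rewrite mulrBl divff // mul1r mulrBl mul1r [in RHS]mulrC.
have G_ge : S / n.+1%:R * (1 + n%:R * (#|U|%:R / W)) <= G.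
  have -> : S / n.+1%:R * (1 + n%:R * (#|U|%:R / W)) = S / n.+1%:R + m * #|U|%:R.
    by rewrite /m; ring.
  by rewrite -lerBrDr; move: key; rewrite mW opprB addrC subrK.
have U_gt0 : 0 < #|U|%:R :> R.
  rewrite ltr0n lt0n; apply/eqP => U0.
  have : S / n.+1%:R * (1 + n%:R * (#|U|%:R / W)) <= 0.
    by apply: le_trans G_ge _; rewrite /G (cards0_eq U0) big_set0.
  by rewrite U0 mul0r mulr0 addr0 mulr1 leNgt divr_gt0 // ltr0Sn.
pose t := #|U|%:R / W.
have t0 : 0 <= t by rewrite divr_ge0.
have GS : S ^+ n.+1 * t ^+ n <= G ^+ n.+1.
  apply: le_trans (_ : (S / n.+1%:R * (1 + n%:R * t)) ^+ n.+1 <= _); last first.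
    apply: lerXn2r G_ge; rewrite nnegrE.
      by rewrite mulr_ge0 ?divr_ge0 // addr_ge0 // mulr_ge0.
    by apply: sumr_ge0.
  rewrite [(S / _ * _) ^+ _]exprMn [(S / _) ^+ _]expr_div_n.
  have -> : S ^+ n.+1 * t ^+ n =
    S ^+ n.+1 / n.+1%:R ^+ n.+1 * (n.+1%:R ^+ n.+1 * t ^+ n).
    by rewrite mulrA mulfVK // expf_neq0.
  by rewrite ler_wpM2l ?weighted_AGM // divr_ge0 ?exprn_ge0.
have := le_trans GS (HU U UX).
rewrite /t expr_div_n mulrA ler_pdivrMr ?exprn_gt0 //.
rewrite -mulrA [_ ^+ n * W ^+ n]mulrC mulrA.
by rewrite ler_pM2r // exprn_gt0.
Qed.

(* Weak L^2 embeds in L^1; the induction removes a minimum of [G]. *)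
Lemma weak_strong (J : finType) (G : J -> R) (B : R) (Y : {set J}) :
  0 <= B -> (forall y, 0 <= G y) ->
  (forall a : R, 0 <= a -> a ^+ 2 * #|[set y in Y | a <= G y]|%:R <= B) ->
  (\sum_(y in Y) G y) ^+ 2 <= 4 * B * #|Y|%:R.
Proof.
move=> B0 G0; move Em : #|Y| => m; elim: m Y Em => [|m IHm] Y Em HB.
  by rewrite (cards0_eq Em) big_set0 expr0n /= mulr0.
have /card_gt0P[y1 y1Y] : (0 < #|Y|)%N by rewrite Em.
case: (@arg_minP _ _ _ y1 (fun y => y \in Y) G y1Y) => y0 /= y0Y y0min.
pose Y' := Y :\ y0.
have cY' : #|Y'| = m by have := cardsD1 y0 Y; rewrite y0Y Em add1n => -[].
have IH : (\sum_(y in Y') G y) ^+ 2 <= 4 * B * m%:R.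
  apply: IHm => // a a0; apply: le_trans (HB a a0).
  rewrite ler_wpM2l ?exprn_ge0 // ler_nat; apply: subset_leq_card.
  by apply/subsetP => y; rewrite !inE => /andP[/andP[_ ->] ->].
have Ha := HB (G y0) (G0 y0).
have EY : [set y in Y | G y0 <= G y] = Y.
  by apply/setP => y; rewrite inE; case yY: (y \in Y) => //=; rewrite y0min.
rewrite EY Em in Ha.
rewrite (big_setD1 y0) //=.
set s := \sum_(y in _) _ in IH *; set a := G y0 in Ha *.
have s0 : 0 <= s by apply: sumr_ge0.
have a0 : 0 <= a by apply: G0.
have M1 : (1 : R) <= m.+1%:R by rewrite ler1n.
have em : m%:R = m.+1%:R - 1 :> R by rewrite -[m.+1%:R]natr1 addrK.
rewrite {}em in IH.
move: (m.+1%:R) M1 Ha IH => M M1 Ha IH.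
have M0 : 0 < M by lra.
(* (a s M)^2 <= 4 B^2 M (M - 1) <= (2 B (M - 1/2))^2 *)
have h1 : a * s * M <= B * (2 * M - 1).
  rewrite -(@ler_pXn2r _ 2) ?nnegrE ?mulr_ge0 //; try lra.
  have e1 : (a * s * M) ^+ 2 = (a ^+ 2 * M) * (s ^+ 2) * M by ring.
  have e2 : (a ^+ 2 * M) * s ^+ 2 <= B * (4 * B * (M - 1)).
    by apply: ler_pM => //; rewrite ?mulr_ge0 ?exprn_ge0 // ltW.
  have e3 : (a ^+ 2 * M) * s ^+ 2 * M <= B * (4 * B * (M - 1)) * M.
    by rewrite ler_wpM2r // ltW.
  rewrite e1; apply: le_trans e3 _.
  have : 0 <= B ^+ 2 by apply: exprn_ge0.
  nra.
rewrite -(ler_pM2r M0).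
have : s ^+ 2 * M <= 4 * B * (M - 1) * M by rewrite ler_wpM2r // ltW.
nra.
Qed.

End Moments.

(** * Spread functions and their codegrees *)

Section Spread.
Variable R : realFieldType.

(** On a level set V of [g ^+ P] at height [a], the minimum of [g] raised to the power n+1 = 2P is
    at least a^2. The hypothesis on V thus becomes the weak-type bound required by [weak_strong]. *)
Lemma weak_strong_power (J : finType) (g : J -> R) (B : R) (Y : {set J})
    (n P : nat) :
  (n.+1 = 2 * P)%N -> 0 <= B -> (forall y, 0 <= g y) ->
  (forall V : {set J}, V \subset Y ->
     (\sum_(y in V) g y) ^+ n.+1 <= B * #|V|%:R ^+ n) ->
  (\sum_(y in Y) g y ^+ P) ^+ 2 <= 4 * B * #|Y|%:R.
Proof.
move=> nP B0 g0 HV; apply: weak_strong => // [y|a a0]; first exact: exprn_ge0.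
set V := [set _ in _ | _].
have VY : V \subset Y by apply/subsetP => y; rewrite inE => /andP[].
have [->|/set0Pn[y1 y1V]] := eqVneq V set0; first by rewrite cards0 mulr0.
case: (@arg_minP _ _ _ y1 (fun y => y \in V) g y1V) => y0 /= y0V y0min.
have V0 : 0 < #|V|%:R :> R by rewrite ltr0n; apply/card_gt0P; exists y1.
have ag : a <= g y0 ^+ P by move: y0V; rewrite inE => /andP[].
rewrite -(ler_pM2r (exprn_gt0 n V0)); apply: le_trans (HV V VY).
rewrite -mulrA -exprS.
apply: le_trans (_ : (g y0 * #|V|%:R) ^+ n.+1 <= _).
  rewrite exprMn ler_wpM2r ?exprn_ge0 //.
  by rewrite nP mulnC exprM lerXn2r // nnegrE exprn_ge0.
apply: lerXn2r; rewrite ?nnegrE ?mulr_ge0 ?sumr_ge0 //.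
rewrite mulr_natr -sumr_const; exact: ler_sum.
Qed.

(** Expanding the power over tuples [phi] of elements of [X] separates [y] from [z]. When both
    functions coincide, every summand is a square, whence [moment_ge0]. *)
Lemma moment_expand (I J L : finType) (f : I -> J -> R) (g : I -> L -> R)
    (X : {set I}) (Y : {set J}) (Z : {set L}) (m : nat) :
  \sum_(y in Y) \sum_(z in Z) (\sum_(x in X) f x y * g x z) ^+ m =
  \sum_(phi : {ffun 'I_m -> I} | phi \in ffun_on X)
    (\sum_(y in Y) \prod_i f (phi i) y) * (\sum_(z in Z) \prod_i g (phi i) z).
Proof.
have E y z : (\sum_(x in X) f x y * g x z) ^+ m =
    \sum_(phi : {ffun 'I_m -> I} | phi \in ffun_on X)
       (\prod_i f (phi i) y) * (\prod_i g (phi i) z).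
  rewrite -[X in _ ^+ X](card_ord m) -prodr_const bigA_distr_big /=.
  by apply: eq_bigr => phi _; rewrite big_split.
under eq_bigr => y _ do under eq_bigr => z _ do rewrite E.
under eq_bigr => y _ do rewrite exchange_big /=.
rewrite exchange_big /=; apply: eq_bigr => phi _.
rewrite mulr_suml; apply: eq_bigr => y _.
by rewrite mulr_sumr.
Qed.

Lemma moment_ge0 (I J : finType) (f : I -> J -> R)
    (X : {set I}) (Y : {set J}) (m : nat) :
  0 <= \sum_(y in Y) \sum_(y' in Y) (\sum_(x in X) f x y * f x y') ^+ m.
Proof.
by rewrite moment_expand sumr_ge0 // => phi _; rewrite -expr2 sqr_ge0.
Qed.

(** For each tuple [phi] this is 2abst <= b^2 s^2 + a^2 t^2. The free weights [a] and [b] compensate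
    for different sizes of the two sides. *)
Lemma moment_cross (I J L : finType) (f : I -> J -> R) (g : I -> L -> R)
    (X : {set I}) (Y : {set J}) (Z : {set L}) (m : nat) (a b : R) :
  2 * a * b *
    \sum_(y in Y) \sum_(z in Z) (\sum_(x in X) f x y * g x z) ^+ m <=
  b ^+ 2 * (\sum_(y in Y) \sum_(y' in Y) (\sum_(x in X) f x y * f x y') ^+ m) +
  a ^+ 2 * (\sum_(z in Z) \sum_(z' in Z) (\sum_(x in X) g x z * g x z') ^+ m).
Proof.
rewrite !moment_expand !mulr_sumr -big_split /=; apply: ler_sum => phi _.
set s := \sum_(y in Y) _; set t := \sum_(z in Z) _.
by have := sqr_ge0 (b * s - a * t); lra.
Qed.

(* Subrectangles of relative size [rho] have density at most [rho ^ -(1 / n.+1)]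
   with respect to [r]. *)
Definition spread (I J : finType) (n : nat) (H : R) (X : {set I}) (Y : {set J})
    (r : I -> J -> R) : Prop :=
  (forall x y, 0 <= r x y <= H) /\
  forall (U : {set I}) (V : {set J}), U \subset X -> V \subset Y ->
    (\sum_(x in U) \sum_(y in V) r x y) ^+ n.+1 <=
      (#|U|%:R * #|V|%:R) ^+ n * (#|X|%:R * #|Y|%:R).

Section SpreadTheory.
Variables (I J : finType) (n P : nat) (H : R) (X : {set I}) (Y : {set J}).
Variable r : I -> J -> R.
Hypothesis nP : (n.+1 = 2 * P)%N.
Hypothesis H1 : 1 <= H.
Hypothesis rS : spread n H X Y r.

Let r_ge0 x y : 0 <= r x y. Proof. by case/andP: (rS.1 x y). Qed.
Let r_leH x y : r x y <= H. Proof. by case/andP: (rS.1 x y). Qed.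
Let nx : R := #|X|%:R.
Let ny : R := #|Y|%:R.
Let nx0 : 0 <= nx. Proof. by []. Qed.
Let ny0 : 0 <= ny. Proof. by []. Qed.
Let H0 : 0 < H. Proof. exact: lt_le_trans ltr01 H1. Qed.

(** With [y'] fixed, [r x y' / H] is a weight in [0, 1] on [X], so [weighted_sum_bound] applies to
    the degrees into [V]; its hypothesis on subsets of [X] is the spread condition. *)
Lemma codegree_weak (y' : J) (V : {set J}) : V \subset Y ->
  (\sum_(y in V) \sum_(x in X) r x y * r x y') ^+ n.+1 <=
    (H * (nx * ny) * (\sum_(x in X) r x y') ^+ n) * #|V|%:R ^+ n.
Proof.
move=> VY; rewrite exchange_big /=.
pose g x := \sum_(y in V) r x y.
have -> : \sum_(x in X) \sum_(y in V) r x y * r x y' =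
    H * \sum_(x in X) (r x y' / H) * g x.
  rewrite mulr_sumr; apply: eq_bigr => x _.
  rewrite mulrA [H * _]mulrC mulfVK ?gt_eqF // mulr_sumr.
  by apply: eq_bigr => y _; rewrite mulrC.
have := @weighted_sum_bound R I X g (fun x => r x y' / H)
   (#|V|%:R ^+ n * (nx * ny)) n.
move=> /(_ _ _ _ _) W; rewrite exprMn.
have -> : H * (nx * ny) * (\sum_(x in X) r x y') ^+ n * #|V|%:R ^+ n =
   H ^+ n.+1 * (#|V|%:R ^+ n * (nx * ny) * (\sum_(x in X) r x y' / H) ^+ n).
  rewrite -mulr_suml expr_div_n exprS.
  have HH : H ^+ n != 0 by rewrite expf_neq0 // gt_eqF.
  move: (H ^+ n) HH => h hh; field; exact: hh.
rewrite ler_wpM2l ?exprn_ge0 // ?(ltW H0) //; apply: W.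
- by rewrite mulr_ge0 ?exprn_ge0 ?mulr_ge0.
- by move=> x; apply: sumr_ge0.
- by move=> x; rewrite divr_ge0 ?(ltW H0) //= ler_pdivrMr // mul1r.
- move=> U UX; apply: le_trans (rS.2 U V UX VY) _.
  by rewrite exprMn -!mulrA; apply: eq_ler; ring.
Qed.

(** [weak_strong_power] is used twice: for the degrees [w], and for the codegrees with a fixed [y'],
    where the bound involves [w y']. Summing the latter over [y'] consumes the former. *)
Lemma codegree_moment :
  \sum_(y in Y) \sum_(y' in Y) (\sum_(x in X) r x y * r x y') ^+ P <=
    6 * H * ny ^+ 2 * nx ^+ P.
Proof.
pose w y := \sum_(x in X) r x y.
have w0 y : 0 <= w y by apply: sumr_ge0.
have wP : \sum_(y in Y) w y ^+ P <= 2 * nx ^+ P * ny.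
  have := @weak_strong_power J w (nx ^+ n.+1 * ny) Y n P nP.
  move=> /(_ _ w0 _) W.
  rewrite -(@ler_pXn2r _ 2) ?nnegrE ?mulr_ge0 ?exprn_ge0 ?sumr_ge0 //; last first.
    by move=> y _; apply: exprn_ge0.
  apply: le_trans (W _ _) _; first by rewrite mulr_ge0 // exprn_ge0.
    move=> V VY; rewrite [in leLHS]exchange_big /=.
    apply: le_trans (rS.2 X V (subxx _) VY) _.
    by rewrite -/nx -/ny exprMn exprS; apply: eq_ler; ring.
  by rewrite nP mulnC exprM -/ny; apply: eq_ler; ring.
have KP y' : \sum_(y in Y) (\sum_(x in X) r x y * r x y') ^+ P <=
    2 * H * ny * (nx ^+ P + w y' ^+ P).
  have K0 y : 0 <= \sum_(x in X) r x y * r x y'.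
    by apply: sumr_ge0 => x _; apply: mulr_ge0.
  have := @weak_strong_power J (fun y => \sum_(x in X) r x y * r x y')
    (H * (nx * ny) * w y' ^+ n) Y n P nP.
  move=> /(_ _ K0 (codegree_weak y')) W.
  have HH : 0 <= H by apply: ltW.
  rewrite -(@ler_pXn2r _ 2) ?nnegrE ?mulr_ge0 ?addr_ge0 ?exprn_ge0 ?sumr_ge0 //; last first.
    by move=> y _; apply: exprn_ge0.
  apply: le_trans (W _) _; first by rewrite !mulr_ge0 ?exprn_ge0.
  (* The left side is at most the larger of [nx] and [w y'] raised to the power n+1 = 2P. *)
  have aux : nx * w y' ^+ n <= (nx ^+ P + w y' ^+ P) ^+ 2.
    apply: le_trans (_ : nx ^+ n.+1 + w y' ^+ n.+1 <= _).
      have [h|h] := leP (w y') nx.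
        rewrite [nx ^+ n.+1]exprS -[leLHS]addr0 lerD ?exprn_ge0 //.
        by rewrite ler_wpM2l // lerXn2r ?nnegrE.
      rewrite [w y' ^+ n.+1]exprS -[leLHS]add0r lerD ?exprn_ge0 //.
      by rewrite ler_wpM2r ?exprn_ge0 // ltW.
    rewrite nP mulnC !exprM sqrrD -addrA lerD2l ler_wpDl // mulrn_wge0 //.
    by rewrite mulr_ge0 ?exprn_ge0.
  rewrite -/ny.
  have -> : 4 * (H * (nx * ny) * w y' ^+ n) * ny =
      4 * ny ^+ 2 * (H * (nx * w y' ^+ n)) by ring.
  have -> : (2 * H * ny * (nx ^+ P + w y' ^+ P)) ^+ 2 =
      4 * ny ^+ 2 * (H ^+ 2 * (nx ^+ P + w y' ^+ P) ^+ 2) by ring.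
  rewrite ler_wpM2l ?mulr_ge0 ?exprn_ge0 // ler_pM ?mulr_ge0 ?exprn_ge0 //.
  by rewrite expr2 ler_peMl.
rewrite exchange_big /=.
apply: le_trans (ler_sum _ (fun y' _ => KP y')) _.
rewrite -mulr_sumr big_split /= sumr_const -[_ *+ #|_|]mulr_natr -/ny.
have : 2 * H * ny * (nx ^+ P * ny + \sum_(y' in Y) w y' ^+ P) <=
   2 * H * ny * (nx ^+ P * ny + 2 * nx ^+ P * ny).
  by rewrite ler_wpM2l ?lerD2l // !mulr_ge0 // ltW.
move/le_trans; apply; apply: eq_ler; ring.
Qed.

(* Expanding [(nx + F) ^+ P], all summands have nonnegative total, so each of them
   is bounded by the moment of order [P]; [P] is odd since [nx + F] may be negative. *)
Lemma deviation_moment (c : R) (Yg : {set J}) (p : nat) :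
  odd P -> (p <= P)%N -> 0 <= c -> 0 < nx -> Yg \subset Y ->
  (forall y, y \in Yg -> (1 - c) * nx <= \sum_(x in X) r x y) ->
  'C(P, p)%:R * (\sum_(y in Yg) \sum_(y' in Yg)
    (\sum_(x in X) (r x y - 1) * (r x y' - 1)) ^+ p) <=
  (1 + 2 * c) ^+ P * (7 * H * ny ^+ 2 * nx ^+ p).
Proof.
move=> oddP pP c0 nx_gt0 YgY deg.
pose K y y' := \sum_(x in X) r x y * r x y'.
pose F y y' := \sum_(x in X) (r x y - 1) * (r x y' - 1).
pose w y := \sum_(x in X) r x y.
have FE y y' : F y y' = K y y' - w y - w y' + nx.
  rewrite /F /K /w /nx -sum1_card natr_sum -!sumrB -big_split /=.
  by apply: eq_bigr => x _; ring.
have K0 y y' : 0 <= K y y' by apply: sumr_ge0 => x _; apply: mulr_ge0.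
(* Since both degrees are at least (1 - c) nx, nx + F is at most K + 2c nx, hence at most 1 + 2c
   times the larger of K and nx. *)
have up y y' : y \in Yg -> y' \in Yg ->
    (nx + F y y') ^+ P <= (1 + 2 * c) ^+ P * (nx ^+ P + K y y' ^+ P).
  move=> yY y'Y.
  have c1 : 0 <= 1 + 2 * c by rewrite addr_ge0 ?mulr_ge0.
  apply: le_trans (_ : (K y y' + 2 * c * nx) ^+ P <= _).
    suff le1 : nx + F y y' <= K y y' + 2 * c * nx.
      have [le0|gt0] := leP 0 (nx + F y y').
        by apply: lerXn2r => //; rewrite nnegrE // (le_trans le0).
      apply: (@le_trans _ _ 0).
        by rewrite exprn_odd_le0 // ltW.
      by rewrite exprn_ge0 // addr_ge0 // !mulr_ge0.
    by rewrite FE; have := deg y yY; have := deg y' y'Y; rewrite -!/(w _); lra.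
  have cn : 0 <= 2 * c * nx by rewrite !mulr_ge0.
  have [h|h] := leP (K y y') nx.
    apply: (@le_trans _ _ (((1 + 2 * c) * nx) ^+ P)).
      apply: lerXn2r; rewrite ?nnegrE ?addr_ge0 ?mulr_ge0 //.
      by lra.
    by rewrite exprMn ler_wpM2l ?exprn_ge0 // lerDl exprn_ge0.
  apply: (@le_trans _ _ (((1 + 2 * c) * K y y') ^+ P)).
    apply: lerXn2r; rewrite ?nnegrE ?addr_ge0 ?mulr_ge0 //.
    have : 2 * c * nx <= 2 * c * K y y' by rewrite ler_wpM2l ?mulr_ge0 // ltW.
    lra.
  by rewrite exprMn ler_wpM2l ?exprn_ge0 // lerDr exprn_ge0.
have total : \sum_(y in Yg) \sum_(y' in Yg) (nx + F y y') ^+ P <=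
    (1 + 2 * c) ^+ P * (7 * H * ny ^+ 2 * nx ^+ P).
  have c1 : 0 <= (1 + 2 * c) ^+ P by rewrite exprn_ge0 // addr_ge0 ?mulr_ge0.
  apply: le_trans (_ : \sum_(y in Yg) \sum_(y' in Yg)
      (1 + 2 * c) ^+ P * (nx ^+ P + K y y' ^+ P) <= _).
    by apply: ler_sum => y yY; apply: ler_sum => y' y'Y; apply: up.
  under eq_bigr => y _ do rewrite -mulr_sumr.
  rewrite -mulr_sumr ler_wpM2l //.
  have term0 y y' : 0 <= nx ^+ P + K y y' ^+ P by rewrite addr_ge0 ?exprn_ge0.
  apply: le_trans (_ : \sum_(y in Y) \sum_(y' in Y)
      (nx ^+ P + K y y' ^+ P) <= _).
    apply: le_trans (_ : \sum_(y in Yg) \sum_(y' in Y)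
        (nx ^+ P + K y y' ^+ P) <= _).
      apply: ler_sum => y _; rewrite [leRHS](big_setID Yg) /= (setIidPr YgY).
      by rewrite lerDl sumr_ge0.
    rewrite [leRHS](big_setID Yg) /= (setIidPr YgY) lerDl sumr_ge0 // => y _.
    by rewrite sumr_ge0.
  under eq_bigr => y _ do rewrite big_split /= sumr_const.
  rewrite big_split /= sumr_const -!mulrnA -[_ *+ (_ * _)]mulr_natr natrM.
  have := codegree_moment; rewrite -/nx -/ny.
  (* As H is at least 1, the term [nx ^+ P] only raises the constant of [codegree_moment] from 6 to
     7. *)
  have : nx ^+ P * ny ^+ 2 <= H * (nx ^+ P * ny ^+ 2).
    by rewrite ler_peMl // mulr_ge0 ?exprn_ge0.
  rewrite /K expr2; lra.
have expand : \sum_(y in Yg) \sum_(y' in Yg) (nx + F y y') ^+ P =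
    \sum_(i < P.+1) (nx ^+ (P - i) * 'C(P, i)%:R) *
      \sum_(y in Yg) \sum_(y' in Yg) F y y' ^+ i.
  under eq_bigr => y _ do (under eq_bigr => y' _ do rewrite exprDn).
  under eq_bigr => y _ do rewrite exchange_big /=.
  rewrite exchange_big /=; apply: eq_bigr => i _.
  rewrite mulr_sumr; apply: eq_bigr => y _.
  rewrite mulr_sumr; apply: eq_bigr => y' _.
  by rewrite -mulr_natr; ring.
have pP' : (p < P.+1)%N by rewrite ltnS.
have : nx ^+ (P - p) * 'C(P, p)%:R *
      (\sum_(y in Yg) \sum_(y' in Yg) F y y' ^+ p) <=
    (1 + 2 * c) ^+ P * (7 * H * ny ^+ 2 * nx ^+ P).
  apply: le_trans total; rewrite expand (bigD1 (Ordinal pP')) //= lerDl.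
  apply: sumr_ge0 => i _; rewrite mulr_ge0 ?mulr_ge0 ?exprn_ge0 //.
  exact: moment_ge0.
rewrite -[in nx ^+ P](subnK pP) exprD.
have -> : (1 + 2 * c) ^+ P * (7 * H * ny ^+ 2 * (nx ^+ (P - p) * nx ^+ p)) =
  nx ^+ (P - p) * ((1 + 2 * c) ^+ P * (7 * H * ny ^+ 2 * nx ^+ p)) by ring.
by rewrite -mulrA ler_pM2l // exprn_gt0.
Qed.

End SpreadTheory.

(** Each factor of the falling factorial of [P] is at least [M * p], while p! is at most p^p. *)
Lemma expn_le_bin (M p P : nat) : (0 < p)%N -> (M * p + p <= P.+1)%N ->
  (M ^ p <= 'C(P, p))%N.
Proof.
move=> p0 MP; rewrite -(@leq_pmul2r p`!) ?fact_gt0 // bin_ffact.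
apply: (@leq_trans ((M * p) ^ p)%N).
  rewrite expnMn leq_mul2l -ffactnn ffact_prod; apply/orP; right.
  rewrite -[X in (_ <= _ ^ X)%N](card_ord p) -prod_nat_const.
  by apply: leq_prod => i _; rewrite leq_subr.
rewrite ffact_prod -[X in (_ ^ X <= _)%N](card_ord p) -prod_nat_const.
by apply: leq_prod => i _; have := ltn_ord i; lia.
Qed.

(** Markov's inequality for the p-th moment of the mixed centred codegrees. This moment is
    controlled by the two unmixed ones through [moment_cross], and those by [deviation_moment]. *)
Lemma spread_mixing (I J L : finType) (p : nat) (H c : R)
    (X : {set I}) (Y Yg : {set J}) (Z Zg : {set L})
    (r : I -> J -> R) (s : I -> L -> R) :
  (0 < p)%N -> ~~ odd p -> 1 <= H -> 0 <= c <= 1 / 100 ->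
  (0 < #|X|)%N -> (0 < #|Y|)%N -> (0 < #|Z|)%N ->
  spread (34 * p).+1 H X Y r -> spread (34 * p).+1 H X Z s ->
  Yg \subset Y -> Zg \subset Z ->
  (forall y, y \in Yg -> (1 - c) * #|X|%:R <= \sum_(x in X) r x y) ->
  (forall z, z \in Zg -> (1 - c) * #|X|%:R <= \sum_(x in X) s x z) ->
  #|[set yz in setX Yg Zg | \sum_(x in X) r x yz.1 * s x yz.2 <= #|X|%:R / 2]|%:R
    * 2 ^+ p <= 7 * H * (#|Y|%:R * #|Z|%:R).
Proof.
move=> p0 evp H1 /andP[c0 c1] X0 Y0 Z0 rS sS YgY ZgZ degr degs.
(* As [p] is even, P is odd. P >= 17p gives a binomial coefficient of at least 16^p, and P <= 18p
   keeps (1 + 2c)^P below 2^p; the remaining 8^p outweighs the 4^p lost in Markov's inequality. *)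
pose P := (17 * p).+1.
have nP : ((34 * p).+2 = 2 * P)%N by rewrite /P; lia.
have oddP : odd P by rewrite /P oddS oddM /= evp.
have pP : (p <= P)%N by rewrite /P; lia.
have PB : (16 * p + p <= P.+1)%N by rewrite /P; lia.
have PU : (P <= 18 * p)%N by rewrite /P; lia.
have nx0 : (0 : R) < #|X|%:R by rewrite ltr0n.
have ny0 : (0 : R) < #|Y|%:R by rewrite ltr0n.
have nz0 : (0 : R) < #|Z|%:R by rewrite ltr0n.
have binP : 16 ^+ p <= 'C(P, p)%:R :> R.
  by rewrite -natrX ler_nat expn_le_bin.
have cP : (1 + 2 * c) ^+ P <= 2 ^+ p.
  have c_ge1 : 1 <= 1 + 2 * c by lra.
  apply: le_trans (_ : (1 + 2 * c) ^+ (18 * p) <= _).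
    by rewrite ler_weXn2l.
  rewrite exprM lerXn2r ?nnegrE ?exprn_ge0 //; first by lra.
  apply: le_trans (_ : (51 / 50) ^+ 18 <= _).
    by rewrite lerXn2r ?nnegrE //; lra.
  by lra.
have dev (M : finType) (W Wg : {set M}) (t : I -> M -> R) :
    spread (34 * p).+1 H X W t -> Wg \subset W ->
    (forall y, y \in Wg -> (1 - c) * #|X|%:R <= \sum_(x in X) t x y) ->
    8 ^+ p * (\sum_(y in Wg) \sum_(y' in Wg)
      (\sum_(x in X) (t x y - 1) * (t x y' - 1)) ^+ p) <=
    7 * H * #|W|%:R ^+ 2 * #|X|%:R ^+ p.
  move=> tS WgW deg.
  have := deviation_moment nP H1 tS oddP pP c0 nx0 WgW deg.
  set m := \sum_(y in Wg) _; set rhs := 7 * H * _ * _ => D.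
  have m0 : 0 <= m by apply: moment_ge0.
  have rhs0 : 0 <= rhs.
    by rewrite !mulr_ge0 ?exprn_ge0 // (le_trans ler01).
  have : 16 ^+ p * m <= 2 ^+ p * rhs.
    apply: le_trans (ler_wpM2r m0 binP) _; apply: le_trans D _.
    exact: ler_wpM2r.
  have -> : 16 ^+ p = 2 ^+ p * 8 ^+ p :> R by rewrite -exprMn; congr (_ ^+ p); ring.
  by rewrite -mulrA ler_pM2l // exprn_gt0.
have devr := dev _ _ _ _ rS YgY degr.
have devs := dev _ _ _ _ sS ZgZ degs.
(* With the weights |Y| and |Z|, both terms on the right get the same bound, proportional to |Y|^2
   |Z|^2. *)
have := moment_cross (fun x y => r x y - 1) (fun x z => s x z - 1) X Yg Zg p
  #|Y|%:R #|Z|%:R.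
set mr := (\sum_(y in Yg) \sum_(y' in Yg) _) in devr *.
set ms := (\sum_(z in Zg) \sum_(z' in Zg) _) in devs *.
pose F y z := \sum_(x in X) (r x y - 1) * (s x z - 1).
rewrite (_ : \sum_(y in Yg) \sum_(z in Zg) _ =
  \sum_(y in Yg) \sum_(z in Zg) F y z ^+ p) // => cross.
set E := [set yz in _ | _].
(* Both degrees are at least 99/100 of |X|, so a codegree of at most |X|/2 forces F <= -|X|/4; the
   even power removes the sign. *)
have EF yz : yz \in E -> (#|X|%:R / 4) ^+ p <= F yz.1 yz.2 ^+ p.
  case: yz => y z; rewrite !inE /= => /andP[/andP[yY zZ] K12].
  have FE : F y z = \sum_(x in X) r x y * s x z - \sum_(x in X) r x y
      - \sum_(x in X) s x z + #|X|%:R.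
    rewrite /F -sum1_card natr_sum -!sumrB -big_split /=.
    by apply: eq_bigr => x _; ring.
  have Fle : #|X|%:R / 4 <= - F y z.
    have := degr y yY; have := degs z zZ.
    have : c * #|X|%:R <= 1 / 100 * #|X|%:R by rewrite ler_pM2r.
    by rewrite FE; lra.
  have -> : F y z ^+ p = (- F y z) ^+ p.
    by rewrite exprNn -signr_odd (negbTE evp) mul1r.
  have X4 : 0 <= #|X|%:R / 4 :> R by rewrite divr_ge0 // ltW.
  by have F0 := le_trans X4 Fle; apply: lerXn2r Fle; rewrite nnegrE.
have Esum : #|E|%:R * (#|X|%:R / 4) ^+ p <=
    \sum_(y in Yg) \sum_(z in Zg) F y z ^+ p.
  rewrite pair_big /= mulr_natl -sumr_const.
  have Fp0 y z : 0 <= F y z ^+ p.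
    by rewrite exprn_even_ge0.
  apply: le_trans (_ : \sum_(yz in E) F yz.1 yz.2 ^+ p <= _).
    by apply: ler_sum => yz /EF.
  rewrite [leRHS](bigID (fun yz => yz \in E)) /=.
  rewrite [leLHS](eq_bigl (fun yz =>
      ((yz.1 \in Yg) && (yz.2 \in Zg)) && (yz \in E))); last first.
    by case=> y z; rewrite !inE /=; case: (y \in Yg); case: (z \in Zg).
  by rewrite lerDl sumr_ge0.
set S := \sum_(y in Yg) \sum_(z in Zg) F y z ^+ p in cross Esum.
have total : 8 ^+ p * S <= 7 * H * (#|Y|%:R * #|Z|%:R) * #|X|%:R ^+ p.
  have pos : (0 : R) < 2 * #|Y|%:R * #|Z|%:R by rewrite !mulr_gt0.
  rewrite -(ler_pM2l pos).
  have h8 : (0 : R) <= 8 ^+ p by rewrite exprn_ge0.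
  have := ler_wpM2l h8 cross.
  have y2 : (0 : R) <= #|Y|%:R ^+ 2 by rewrite exprn_ge0.
  have z2 : (0 : R) <= #|Z|%:R ^+ 2 by rewrite exprn_ge0.
  have := ler_wpM2l z2 devr; have := ler_wpM2l y2 devs.
  set x1 := 8 ^+ p; set x2 := #|X|%:R ^+ p.
  lra.
have h8 : (0 : R) <= 8 ^+ p by rewrite exprn_ge0.
have := le_trans (ler_wpM2l h8 Esum) total.
have -> : 8 ^+ p * (#|E|%:R * (#|X|%:R / 4) ^+ p) =
    #|E|%:R * 2 ^+ p * #|X|%:R ^+ p :> R.
  have -> : 8 ^+ p = 2 ^+ p * 4 ^+ p :> R by rewrite -exprMn; congr (_ ^+ p); ring.
  have : (4 : R) ^+ p != 0 by rewrite expf_neq0 // pnatr_eq0.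
  rewrite expr_div_n; move: (4 ^+ p) => a a0; field; exact: a0.
by rewrite ler_pM2r // exprn_gt0.
Qed.

End Spread.

(** * Second moment of the scalar-product predicate *)

Section DotProduct.
Variables (F : finFieldType) (k : nat).
Notation V := 'rV[F]_k.
Let q := #|F|.
Let N := #|{: V}|.

Lemma dotpC (x y : V) : dotp x y = dotp y x.
Proof. by apply: eq_bigr => i _; rewrite mulrC. Qed.

Lemma dotpDr (x y z : V) : dotp x (y + z) = dotp x y + dotp x z.
Proof. by rewrite -big_split; apply: eq_bigr => i _; rewrite mxE mulrDr. Qed.

Lemma dotpZr (x y : V) a : dotp x (a *: y) = a * dotp x y.
Proof. by rewrite mulr_sumr; apply: eq_bigr => i _; rewrite mxE; ring. Qed.

Lemma dotpBr (x y z : V) : dotp x (y - z) = dotp x y - dotp x z.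
Proof. by rewrite -scaleN1r dotpDr dotpZr mulN1r. Qed.

Lemma dotpE (x y : V) : dotp x y = (x *m y^T) 0 0.
Proof. by rewrite mxE; apply: eq_bigr => i _; rewrite mxE. Qed.

(** The columns of [cokermx A] are orthogonal to the row space of [A], and one of them is not
    orthogonal to [v]; rescaling it gives [u]. *)
Lemma dual_vector (m : nat) (A : 'M[F]_(m, k)) (v : V) : ~~ (v <= A)%MS ->
  exists2 u : V, dotp v u = 1 & forall w : V, (w <= A)%MS -> dotp w u = 0.
Proof.
rewrite submxE => /rV0Pn[j vj].
pose u : V := ((v *m cokermx A) 0 j)^-1 *: (col j (cokermx A))^T.
have dE w : dotp w u = ((v *m cokermx A) 0 j)^-1 * (w *m cokermx A) 0 j.
  rewrite dotpZr dotpE trmxK; congr (_ * _).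
  by rewrite !mxE; apply: eq_bigr => i _; rewrite mxE.
exists u => [|w]; first by rewrite dE mulVf.
by rewrite submxE dE => /eqP ->; rewrite [X in _ * X]mxE mulr0.
Qed.

(** Translation by multiples of [u] preserves [Q] and permutes the level sets of the scalar product
    with [v], so these [q] slices have equal size. *)
Lemma card_hyperplane (Q : pred V) (v u : V) (c : F) :
  dotp v u = 1 -> (forall y t, Q (y + t *: u) = Q y) ->
  (#|[set y | Q y && (dotp v y == c)]| * q = #|[set y | Q y]|)%N.
Proof.
move=> vu Qu.
have card_c b : #|[set y | Q y && (dotp v y == b)]| =
    #|[set y | Q y && (dotp v y == c)]|.
  rewrite -[RHS](card_imset _ (@addIr _ ((b - c) *: u))); congr (#|pred_of_set _|).
  apply/setP => y; rewrite [LHS]inE; apply/idP/imsetP => [/andP[Qy /eqP vy]|[y']].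
    exists (y - (b - c) *: u); last by rewrite subrK.
    by rewrite inE -scaleNr Qu Qy dotpDr dotpZr vu vy; apply/eqP; ring.
  rewrite inE => /andP[Qy' /eqP vy'] ->.
  by rewrite Qu Qy' dotpDr dotpZr vu vy'; apply/eqP; ring.
have -> : #|[set y | Q y]| = (\sum_(b : F) #|[set y | Q y && (dotp v y == b)]|)%N.
  rewrite -sum1_card (partition_big (dotp v) predT) //=.
  apply: eq_bigr => b _; rewrite -sum1_card; apply: eq_bigl => y.
  by rewrite !inE.
under eq_bigr => b _ do rewrite card_c.
by rewrite sum_nat_const mulnC.
Qed.

Lemma card_submx (m : nat) (A : 'M[F]_(m, k)) :
  (#|[set x : V | (x <= A)%MS]| <= q ^ m)%N.
Proof.
have -> : (q ^ m)%N = #|{: 'rV[F]_m}| by rewrite card_mx mul1n.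
apply: leq_trans (leq_imset_card (fun u : 'rV[F]_m => u *m A) predT).
apply: subset_leq_card; apply/subsetP => x; rewrite inE => /submxP[u ->].
exact: imset_f.
Qed.

(** This lemma and the next two peel off independent linear equations one at a time, each dividing
    the count exactly by [q]. *)
Lemma card_dotp1 (z : V) (a : F) : z != 0 ->
  (#|[set y | dotp z y == a]| * q = N)%N.
Proof.
move=> z0.
have /dual_vector[u zu _] : ~~ (z <= (0 : 'M[F]_(1, k)))%MS.
  by apply: contra z0 => /submx0null ->.
have EN : #|[set y : V | predT y]| = N by rewrite cardsE.
rewrite -EN -(@card_hyperplane predT z u a zu (fun _ _ => erefl)).
by congr (#|pred_of_set _| * _)%N; apply/setP => y; rewrite !inE.
Qed.

Lemma card_dotp2 (z x : V) (a b : F) : z != 0 -> ~~ (x <= z)%MS ->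
  (#|[set y | (dotp z y == a) && (dotp x y == b)]| * q ^ 2 = N)%N.
Proof.
move=> z0 /dual_vector[u xu uz].
rewrite expnS expn1 mulnA (@card_hyperplane (fun y => dotp z y == a) x u b xu).
  exact: card_dotp1.
by move=> y t; rewrite dotpDr dotpZr (uz z) // mulr0 addr0.
Qed.

Lemma card_dotp3 (z z' x : V) (a b c : F) : z != 0 -> ~~ (z' <= z)%MS ->
  ~~ (x <= col_mx z z')%MS ->
  (#|[set y | (dotp z y == a) && (dotp z' y == b) && (dotp x y == c)]| * q ^ 3
    = N)%N.
Proof.
move=> z0 z'z /dual_vector[u xu uz].
rewrite expnS mulnA (@card_hyperplane
  (fun y => (dotp z y == a) && (dotp z' y == b)) x u c xu).
  exact: card_dotp2.
have [uz1 uz2] : dotp z u = 0 /\ dotp z' u = 0.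
  have := submx_refl (col_mx z z'); rewrite col_mx_sub => /andP[h1 h2].
  by split; apply: uz.
by move=> y t; rewrite !dotpDr !dotpZr uz1 uz2 !mulr0 !addr0.
Qed.

Definition pairs1 (z : V) := [set xy : V * V | eq_dotp xy.1 xy.2 z].
Definition pairs2 (z z' : V) :=
  [set xy : V * V | eq_dotp xy.1 xy.2 z && eq_dotp xy.1 xy.2 z'].

Lemma card_pairs (Q : V -> V -> bool) :
  #|[set xy : V * V | Q xy.1 xy.2]| = (\sum_x #|[set y | Q x y]|)%N.
Proof.
rewrite -sum1_card (eq_bigl (fun xy : V * V => Q xy.1 xy.2)); last first.
  by move=> xy; rewrite inE.
rewrite -(pair_big_dep predT Q (fun _ _ => 1%N)) /=; apply: eq_bigr => x _.
by rewrite -sum1_card; apply: eq_bigl => y; rewrite inE.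
Qed.

(** For [x] outside the line spanned by [z], which has at most [q] points, the predicate imposes two
    independent linear equations on [y]. *)
Lemma card_pairs1 (z : V) : z != 0 -> ((N - q) * N <= #|pairs1 z| * q ^ 2)%N.
Proof.
move=> z0; rewrite (card_pairs (fun x y => eq_dotp x y z)) big_distrl /=.
pose A := [set x : V | (x <= z)%MS].
apply: (@leq_trans (\sum_(x in ~: A) N)).
  rewrite sum_nat_const leq_mul2r; apply/orP; right.
  have := cardsC A; have := card_submx z; rewrite -/A expn1 -/N; lia.
rewrite [leqRHS](bigID (fun x => x \in ~: A)) /=; apply: leq_trans (leq_addr _ _).
apply: leq_sum => x; rewrite !inE => xA.
rewrite -(card_dotp2 (dotp x z) (dotp x z) z0 xA) leq_mul2r; apply/orP; right.
apply: subset_leq_card; apply/subsetP => y; rewrite !inE /eq_dotp.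
by move=> /andP[/eqP h1 /eqP h2]; rewrite h2 (dotpC y z) h1 !eqxx.
Qed.

(** A pair can exist only if [x] is orthogonal to z - z', which leaves N/q choices. Off the span of
    z and z', three independent equations then leave N/q^3 choices of [y]; the at most q^2 vectors
    in the span are bounded trivially and give the error term. *)
Lemma card_pairs2 (z z' : V) : z != 0 -> ~~ (z' <= z)%MS ->
  (#|pairs2 z z'| * q ^ 4 <= N * N + q ^ 6 * N)%N.
Proof.
move=> z0 z'z.
rewrite (card_pairs (fun x y => eq_dotp x y z && eq_dotp x y z')) big_distrl /=.
pose A := [set x : V | (x <= col_mx z z')%MS].
rewrite (bigID (fun x => x \in A)) /= addnC; apply: leq_add; last first.
  apply: (@leq_trans (\sum_(x in A) N * q ^ 4)).
    by apply: leq_sum => x _; rewrite leq_mul2r max_card orbT.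
  rewrite sum_nat_const.
  apply: leq_trans (leq_mul (card_submx (col_mx z z')) (leqnn _)) _.
  by rewrite [(N * _)%N]mulnC mulnA -expnD.
have zz' : z - z' != 0.
  by rewrite subr_eq0; apply: contraNneq z'z => ->; apply: submx_refl.
pose B := [set x | dotp (z - z') x == 0].
apply: (@leq_trans (\sum_(x in B) N * q)); last first.
  by rewrite sum_nat_const mulnCA (card_dotp1 _ zz').
rewrite big_mkcond [leqRHS]big_mkcond; apply: leq_sum => x _.
have [xA|xA] := ifP; last by [].
have [xB|xB] := ifP.
  rewrite (expnD _ 3 1) expn1 mulnA leq_mul2r; apply/orP; right.
  rewrite inE in xA.
  rewrite -(card_dotp3 (dotp x z) (dotp x z) (dotp x z) z0 z'z xA).
  rewrite leq_mul2r; apply/orP; right.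
  apply: subset_leq_card; apply/subsetP => y; rewrite !inE /eq_dotp.
  case/andP => /andP[/eqP h1 /eqP h2] /andP[/eqP h3 /eqP h4].
  by rewrite (dotpC z y) (dotpC z' y) -h2 -h4 -h3 h1 !eqxx.
rewrite leqn0 muln_eq0 cards_eq0; apply/orP; left.
apply/set0Pn => -[y]; rewrite inE /eq_dotp.
case/andP => /andP[/eqP h1 /eqP h2] /andP[/eqP h3 /eqP h4].
by move: xB; rewrite inE dotpC dotpBr -h1 -h3 subrr eqxx.
Qed.

(** Opening the square gives correlations G z z'. For independent z and z' these are small, and the
    few remaining pairs are bounded trivially. *)
Lemma eq_dotp_variance (Z : {set V}) :
  \sum_(xy : V * V)
    (\sum_(z in Z) (q%:R ^+ 2 * (eq_dotp xy.1 xy.2 z)%:R - 1)) ^+ 2 <=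
  3 * q%:R ^+ 6 * N%:R * #|Z|%:R ^+ 2 + 2 * q%:R ^+ 5 * N%:R ^+ 3 :> rat.
Proof.
pose d (xy : V * V) z : rat := (eq_dotp xy.1 xy.2 z)%:R.
pose e xy z := q%:R ^+ 2 * d xy z - 1.
have q1 : (1 : rat) <= q%:R by rewrite ler1n; apply/card_gt0P; exists 0.
have q0 : (0 : rat) <= q%:R by [].
have N0 : (0 : rat) <= N%:R by [].
pose G z z' := \sum_xy e xy z * e xy z'.
have -> : \sum_(xy : V * V) (\sum_(z in Z) e xy z) ^+ 2 =
    \sum_(z in Z) \sum_(z' in Z) G z z'.
  rewrite /G; under [RHS]eq_bigr => z _ do rewrite exchange_big /=.
  rewrite [RHS]exchange_big /=; apply: eq_bigr => xy _.
  rewrite expr2 mulr_suml; apply: eq_bigr => z _; by rewrite mulr_sumr.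
have Q4 : 1 <= q%:R ^+ 4 :> rat by apply: exprn_ege1.
have Gtriv z z' : G z z' <= q%:R ^+ 4 * N%:R ^+ 2.
  apply: le_trans (_ : \sum_(xy : V * V) q%:R ^+ 4 <= _); last first.
    by rewrite sumr_const card_prod -/N -[_ *+ _]mulr_natr natrM expr2.
  apply: ler_sum => xy _; rewrite /e /d.
  have Q2 : 1 <= q%:R ^+ 2 :> rat by apply: exprn_ege1.
  have -> : q%:R ^+ 4 = q%:R ^+ 2 * q%:R ^+ 2 :> rat by rewrite -exprD.
  by case: eq_dotp; case: eq_dotp => /=; nra.
(* The four main terms N^2 cancel. Only an upper bound on [pairs2] and lower bounds on [pairs1]
   enter, which is why one-sided counts suffice. *)
have Ggen z z' : z != 0 -> ~~ (z' <= z)%MS -> G z z' <= 3 * q%:R ^+ 6 * N%:R.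
  move=> z0 z'z.
  have z'0 : z' != 0 by apply: contraNneq z'z => ->; apply: sub0mx.
  have -> : G z z' = q%:R ^+ 4 * #|pairs2 z z'|%:R - q%:R ^+ 2 * #|pairs1 z|%:R
      - q%:R ^+ 2 * #|pairs1 z'|%:R + N%:R ^+ 2.
    have E1 w : \sum_xy d xy w = #|pairs1 w|%:R.
      rewrite -sum1_card natr_sum [RHS]big_mkcond /=; apply: eq_bigr => xy _.
      by rewrite inE /d; case: eq_dotp.
    have E2 : \sum_xy d xy z * d xy z' = #|pairs2 z z'|%:R.
      rewrite -sum1_card natr_sum [RHS]big_mkcond /=; apply: eq_bigr => xy _.
      by rewrite inE /d; case: eq_dotp; case: eq_dotp; rewrite ?mulr0 ?mulr1.
    have E0 : \sum_(xy : V * V) 1 = N%:R ^+ 2 :> rat.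
      by rewrite sumr_const card_prod natrM expr2.
    rewrite -E1 -E1 -E2 -E0 !mulr_sumr -!sumrB -big_split /=.
    by apply: eq_bigr => xy _; rewrite /e; ring.
  have := card_pairs2 z0 z'z.
  rewrite -(ler_nat rat) natrD !natrM => h2.
  have NqN (w : V) : w != 0 ->
      N%:R ^+ 2 - q%:R * N%:R <= q%:R ^+ 2 * #|pairs1 w|%:R :> rat.
    move=> w0; have := card_pairs1 w0; rewrite -(ler_nat rat) !natrM.
    have : N%:R - q%:R <= (N - q)%:R :> rat.
      by rewrite lerBlDr -natrD ler_nat; lia.
    move=> /(ler_wpM2r N0); lra.
  have := NqN _ z0; have := NqN _ z'0.
  have : q%:R * N%:R <= q%:R ^+ 6 * N%:R :> rat.
    by rewrite ler_wpM2r // ler_eXnr.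
  by move: h2; rewrite expr2; lra.
have Gall z z' : G z z' <= 3 * q%:R ^+ 6 * N%:R +
    (q%:R ^+ 4 * N%:R ^+ 2) * (z == 0)%:R +
    (q%:R ^+ 4 * N%:R ^+ 2) * (z' <= z)%MS%:R.
  have A0 : 0 <= 3 * q%:R ^+ 6 * N%:R :> rat by rewrite !mulr_ge0 ?exprn_ge0.
  have B0 : 0 <= q%:R ^+ 4 * N%:R ^+ 2 :> rat by rewrite !mulr_ge0 ?exprn_ge0.
  have := Gtriv z z'; have := @Ggen z z'.
  case: eqP => _ /=; case: submx => /=; rewrite ?mulr1 ?mulr0 ?addr0; try lra.
apply: le_trans (ler_sum _ (fun z _ => ler_sum _ (fun z' _ => Gall z z'))) _.
under eq_bigr => z _ do rewrite !big_split /= -!mulr_sumr !sumr_const.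
rewrite !big_split /= -!mulr_sumr !sumr_const -!mulrnA.
rewrite natrM [(#|Z| * #|Z|)%:R]natrM -[#|Z|%:R * _]expr2 mulrA -addrA lerD2l.
have s1 : \sum_(z in Z) (z == 0)%:R *+ #|Z| <= N%:R :> rat.
  apply: le_trans (_ : \sum_(z : V) (z == 0)%:R * N%:R <= _); last first.
    rewrite -mulr_suml (bigD1 0) //= eqxx big1 ?addr0 ?mul1r // => z.
    by move/negbTE ->.
  rewrite big_mkcond; apply: ler_sum => z _; case: ifP => _.
    by rewrite -[_ *+ _]mulr_natr ler_wpM2l // ler_nat max_card.
  by rewrite mulr_ge0.
have s2 : \sum_(z in Z) \sum_(z' in Z) (z' <= z)%MS%:R <= N%:R * q%:R :> rat.
  apply: le_trans (_ : \sum_(z in Z) q%:R <= _); last first.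
    by rewrite sumr_const -[_ *+ _]mulr_natl ler_wpM2r // ler_nat max_card.
  apply: ler_sum => z _.
  have := card_submx z; rewrite expn1 -(ler_nat rat); apply: le_trans.
  rewrite -sum1_card natr_sum big_mkcond [leRHS]big_mkcond /=.
  by apply: ler_sum => z' _; rewrite inE; case: ifP; case: submx.
have B0 : 0 <= q%:R ^+ 4 * N%:R ^+ 2 :> rat by rewrite !mulr_ge0 ?exprn_ge0.
have := ler_wpM2l B0 s1; have := ler_wpM2l B0 s2.
have : q%:R ^+ 4 * N%:R ^+ 3 <= q%:R * (q%:R ^+ 4 * N%:R ^+ 3) :> rat.
  by rewrite ler_peMl // mulr_ge0 ?exprn_ge0.
lra.
Qed.

(** The expected size of the fibre in [Z] is |Z| / q^2; heavy pairs exceed twice this value. *)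
Definition heavy (Z : {set V}) : {set V * V} :=
  [set xy : V * V | 2 * #|Z| < q ^ 2 * #|[set z in Z | eq_dotp xy.1 xy.2 z]|]%N.

(** Chebyshev's inequality: a heavy pair contributes at least |Z|^2 to the second moment. *)
Lemma card_heavy (Z : {set V}) (S : nat) : (0 < #|Z|)%N -> (N <= #|Z| * S)%N ->
  (#|heavy Z| <= 5 * q ^ 6 * S ^ 2 * N)%N.
Proof.
move=> Z0 ZS.
have q1 : (1 <= q)%N by apply/card_gt0P; exists 0.
have S1 : (1 <= S)%N.
  case: S ZS => //; rewrite muln0 leqn0 => /eqP N0.
  by have := leq_trans Z0 (max_card (mem Z)); rewrite -/N N0.
have := eq_dotp_variance Z.
set W := \sum_xy _ => HW.
have HL : #|heavy Z|%:R * #|Z|%:R ^+ 2 <= W.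
  rewrite mulr_natl -sumr_const big_mkcond; apply: ler_sum => xy _.
  case: ifP => [|_]; last exact: sqr_ge0.
  rewrite inE => h.
  have -> : \sum_(z in Z) (q%:R ^+ 2 * (eq_dotp xy.1 xy.2 z)%:R - 1) =
     q%:R ^+ 2 * #|[set z in Z | eq_dotp xy.1 xy.2 z]|%:R - #|Z|%:R :> rat.
    rewrite sumrB sumr_const -mulr_sumr; congr (_ * _ - _).
    rewrite -sum1_card natr_sum big_mkcond [RHS]big_mkcond /=.
    by apply: eq_bigr => z _; rewrite inE; case: (z \in Z) => //=; case: eq_dotp.
  move: h; rewrite -(ltr_nat rat) natrM [(q ^ 2 * _)%:R]natrM natrX => h.
  have Z_ge0 : 0 <= #|Z|%:R :> rat by [].
  by rewrite lerXn2r ?nnegrE //; lra.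
have {HL}HW := le_trans HL HW.
have : (#|heavy Z| * #|Z| ^ 2 <= 3 * q ^ 6 * N * #|Z| ^ 2 + 2 * q ^ 5 * N ^ 3)%N.
  rewrite -(ler_nat rat); apply: le_trans (le_trans _ HW) _;
    by apply: eq_ler; ring.
move=> {}HW; rewrite -(@leq_pmul2r (#|Z| ^ 2)) ?expn_gt0 ?Z0 //.
apply: leq_trans HW _.
have e1 : (N ^ 3 <= N * (#|Z| ^ 2 * S ^ 2))%N.
  by rewrite (expnD _ 1 2) expn1 -expnMn leq_mul2l leq_exp2r // ZS orbT.
have e2 : (q ^ 5 <= q ^ 6)%N by rewrite leq_pexp2l.
have e3 : (2 * q ^ 5 * N ^ 3 <= 2 * q ^ 6 * (N * (#|Z| ^ 2 * S ^ 2)))%N.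
  by apply: leq_mul => //; rewrite leq_mul2l e2.
have e4 : (3 * q ^ 6 * N * #|Z| ^ 2 <= 3 * q ^ 6 * N * #|Z| ^ 2 * S ^ 2)%N.
  by rewrite leq_pmulr // expn_gt0 S1.
apply: leq_trans (leq_add e4 e3) _.
by apply: eq_leq; ring.
Qed.

End DotProduct.

(** * One side of a maximal box *)

Section HalfBox.
Variables (I J L : finType) (T : I -> J -> L -> bool).
Variables (X : {set I}) (Y : {set J}) (Z : {set L}) (Hv : {set I * J}).
Variables (n S H q2 N3 : nat).

Definition boxcount (X' : {set I}) (Y' : {set J}) (Z' : {set L}) : nat :=
  (\sum_(x in X') \sum_(y in Y') \sum_(z in Z') T x y z)%N.

Let t := boxcount X Y Z.
Let d x y := (\sum_(z in Z) T x y z)%N.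

Hypothesis N3_gt0 : (0 < N3)%N.
Hypothesis H_ge2 : (2 <= H)%N.
Hypothesis S_def : S = ((2 * H ^ 2) ^ n.+1)%N.
(** [q2] and [N3] stand for q^2 and N^3. With [Z] fixed, its factor in the volumes has been
    cancelled. The section is applied twice, the second time with the roles of the second and third
    coordinates exchanged. *)
Hypothesis max_box : forall (U : {set I}) (V : {set J}),
  U \subset X -> V \subset Y -> (N3 <= #|U| * #|V| * #|Z| * S)%N ->
  (boxcount U V Z ^ n.+1 * (#|X| * #|Y|) ^ n <=
     t ^ n.+1 * (#|U| * #|V|) ^ n)%N.
Hypothesis large_box : (N3 <= #|X| * #|Y| * #|Z| * (2 * H) ^ n.+1)%N.
Hypothesis dense_box : (2 * (#|X| * #|Y| * #|Z|) <= q2 * t * H)%N.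
Hypothesis HvP : forall x y, (x, y) \notin Hv -> (q2 * d x y <= 2 * #|Z|)%N.

Let b_gt0 : (0 < #|X| * #|Y| * #|Z|)%N.
Proof. by case: (posnP (#|X| * #|Y| * #|Z|)) large_box => // ->; lia. Qed.

Let X_gt0 : (0 < #|X|)%N. Proof. by move: b_gt0; rewrite !muln_gt0 => /andP[/andP[]]. Qed.
Let Y_gt0 : (0 < #|Y|)%N. Proof. by move: b_gt0; rewrite !muln_gt0 => /andP[/andP[]]. Qed.
Let Z_gt0 : (0 < #|Z|)%N. Proof. by move: b_gt0; rewrite !muln_gt0 => /andP[/andP[]]. Qed.

Let t_gt0 : (0 < t)%N.
Proof. by case: (posnP t) dense_box b_gt0 => // ->; rewrite muln0 mul0n; lia. Qed.

Let q2_gt0 : (0 < q2)%N.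
Proof. by case: (posnP q2) dense_box b_gt0 => // ->; rewrite !mul0n; lia. Qed.

Let nx : rat := #|X|%:R.
Let ny : rat := #|Y|%:R.
Let nz : rat := #|Z|%:R.
Let tr : rat := t%:R.
Let nx0 : 0 < nx. Proof. by rewrite ltr0n. Qed.
Let ny0 : 0 < ny. Proof. by rewrite ltr0n. Qed.
Let nz0 : 0 < nz. Proof. by rewrite ltr0n. Qed.
Let tr0 : 0 < tr. Proof. by rewrite ltr0n. Qed.

Let denseR : 2 * (nx * ny * nz) <= q2%:R * tr * H%:R.
Proof. by rewrite /nx /ny /nz /tr -!natrM ler_nat. Qed.

(* The normalised degree of [(x, y)] in [T]; the exceptional pairs of [Hv] are
   discarded so that it is bounded by [H]. *)
Definition dens (x : I) (y : J) : rat :=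
  if (x, y) \in Hv then 0 else (d x y)%:R * (nx * ny) / tr.

Lemma dens_ge0 x y : 0 <= dens x y.
Proof.
by rewrite /dens; case: ifP => // _; rewrite divr_ge0 ?mulr_ge0 // ltW.
Qed.

(** Outside [Hv] the count is at most 2|Z|/q2, and [dense_box] says that this is at most [H] times
    the average. *)
Lemma dens_le x y : dens x y <= H%:R.
Proof.
rewrite /dens; case: ifP => // /negbT /HvP.
rewrite -(ler_nat rat) !natrM -/nz => h.
have q0 : 0 < q2%:R :> rat by rewrite ltr0n.
have nxy : 0 <= nx * ny by rewrite mulr_ge0 // ltW.
rewrite ler_pdivrMr // -(ler_pM2l q0) [leLHS]mulrA.
apply: le_trans (ler_wpM2r nxy h) _; move: denseR; lra.
Qed.

Lemma dens_le_count x y : dens x y <= (d x y)%:R * (nx * ny) / tr.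
Proof.
by rewrite /dens; case: ifP => // _; rewrite divr_ge0 ?mulr_ge0 // ltW.
Qed.

(** For a subrectangle large enough to compete this is maximality. Otherwise [large_box] leaves
    slack H^(n+1) below the threshold [S], so |U| |V| H^(n+1) < |X| |Y| and the pointwise bound [H]
    suffices. *)
Lemma dens_spread : spread n H%:R X Y dens.
Proof.
split=> [x y|U V UX VY]; first by rewrite dens_ge0 dens_le.
have sum0 : 0 <= \sum_(x in U) \sum_(y in V) dens x y.
  by apply: sumr_ge0 => x _; apply: sumr_ge0 => y _; apply: dens_ge0.
have [big|small] := leqP N3 (#|U| * #|V| * #|Z| * S).
  have := max_box UX VY big.
  rewrite -(ler_nat rat) !natrM !natrX !natrM -/tr -/nx -/ny.
  set m := (boxcount U V Z)%:R => Hm.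
  have le1 : \sum_(x in U) \sum_(y in V) dens x y <= m * (nx * ny) / tr.
    rewrite /m /boxcount natr_sum !mulr_suml; apply: ler_sum => x _.
    rewrite natr_sum !mulr_suml; apply: ler_sum => y _; exact: dens_le_count.
  apply: le_trans (_ : (m * (nx * ny) / tr) ^+ n.+1 <= _).
    by apply: lerXn2r; rewrite ?nnegrE // (le_trans sum0).
  rewrite expr_div_n ler_pdivrMr ?exprn_gt0 // exprMn [(nx * ny) ^+ n.+1]exprSr.
  have nxy : 0 <= nx * ny by rewrite mulr_ge0 // ltW.
  have := ler_wpM2r nxy Hm; rewrite -/nx -/ny.
  set e1 := m ^+ _; set e2 := (nx * ny) ^+ _; set e3 := tr ^+ _; set e4 := (_ * _) ^+ _.
  by rewrite -mulrA => /le_trans; apply; apply: eq_ler; ring.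
have le1 : \sum_(x in U) \sum_(y in V) dens x y <= H%:R * (#|U|%:R * #|V|%:R).
  apply: le_trans (_ : \sum_(x in U) \sum_(y in V) H%:R <= _).
    by apply: ler_sum => x _; apply: ler_sum => y _; apply: dens_le.
  by rewrite !sumr_const -mulrnA -[_ *+ _]mulr_natr natrM [#|V|%:R * _]mulrC.
apply: le_trans (_ : (H%:R * (#|U|%:R * #|V|%:R)) ^+ n.+1 <= _).
  by apply: lerXn2r; rewrite ?nnegrE // (le_trans sum0).
rewrite exprMn [(#|U|%:R * _) ^+ n.+1]exprSr mulrCA ler_wpM2l ?exprn_ge0 ?mulr_ge0 //.
rewrite -natrX -!natrM ler_nat.
have : (#|U| * #|V| * #|Z| * S < #|X| * #|Y| * #|Z| * (2 * H) ^ n.+1)%N.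
  exact: leq_trans small large_box.
have -> : S = (H ^ n.+1 * (2 * H) ^ n.+1)%N.
  by rewrite S_def -expnMn; congr (_ ^ _)%N; rewrite expnS expn1; lia.
rewrite mulnA ltn_pmul2r; last by rewrite expn_gt0; lia.
rewrite [(_ * #|Z| * _)%N]mulnAC ltn_pmul2r // => /ltnW.
by rewrite [(H ^ _ * _)%N]mulnC.
Qed.

(* Otherwise [Y :\ y] would contradict the maximality of the box, by AM-GM. *)
Lemma min_degree y : y \in Y ->
  (1 - n.+1%:R^-1) * nx <= \sum_(x in X) (d x y)%:R * (nx * ny) / tr.
Proof.
move=> yY; rewrite -!mulr_suml -natr_sum.
set Ty := (\sum_(x in X) d x y)%N.
have nS : (0 : rat) < n.+1%:R by rewrite ltr0n.
suff : (1 - n.+1%:R^-1) * tr <= Ty%:R * ny.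
  move=> h; rewrite ler_pdivlMr //.
  rewrite mulrAC [Ty%:R * _]mulrCA [_ * nx]mulrC ler_pM2l //.
have tD1 : t = (Ty + boxcount X (Y :\ y) Z)%N.
  rewrite /t /boxcount /Ty -big_split /=; apply: eq_bigr => x _.
  by rewrite (big_setD1 y).
have cY : #|Y| = #|Y :\ y|.+1 by rewrite (cardsD1 y) yY.
set a := #|Y :\ y| in cY.
have [a0|a0] := posnP a.
  have -> : Ty%:R * ny = tr.
    rewrite /ny cY a0 mulr1 /tr tD1 /boxcount.
    rewrite [X in (_ + X)%N]big1 ?addn0 // => x _.
    by rewrite (cards0_eq a0) big_set0.
  by rewrite ler_piMl ?(ltW tr0) // gerBl invr_ge0 ltW.
have := @max_box X (Y :\ y) (subxx _) (subD1set _ _); rewrite -/a => /(_ _) Hm.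
have {}Hm : (boxcount X (Y :\ y) Z ^ n.+1 * a.+1 ^ n <= t ^ n.+1 * a ^ n)%N.
  have X_n : (0 < #|X| ^ n)%N by rewrite expn_gt0 X_gt0.
  rewrite -(leq_pmul2l X_n) mulnCA -expnMn -cY [leqRHS]mulnCA -expnMn.
  (* The box without [y] still competes: a + 1 <= 2a <= a H^(n+1), which fits in the slack between
     [large_box] and [S]. *)
  apply: Hm; apply: leq_trans large_box _; rewrite cY S_def.
  have -> : ((2 * H ^ 2) ^ n.+1 = (2 * H) ^ n.+1 * H ^ n.+1)%N.
    by rewrite -expnMn; congr (_ ^ _)%N; rewrite expnS expn1; lia.
  have H2 : (2 <= H ^ n.+1)%N.
    by apply: leq_trans H_ge2 _; rewrite -[leqLHS]expn1 leq_pexp2l //; lia.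
  rewrite [leqRHS]mulnA [leqRHS]mulnAC; apply: leq_mul => //.
  rewrite [leqRHS]mulnAC; apply: leq_mul => //.
  rewrite -mulnA; apply: leq_mul => //.
  by apply: leq_trans (_ : a * 2 <= _)%N; [lia | apply: leq_mul].
rewrite leNgt; apply/negP => lt.
have : boxcount X (Y :\ y) Z = (t - Ty)%N by rewrite tD1; lia.
move: Hm => /[swap] ->; rewrite -(ler_nat rat) !natrM !natrX natrB; last first.
  by rewrite tD1; lia.
rewrite -/tr leNgt => /negP; apply.
have ar0 : (0 : rat) < a%:R by rewrite ltr0n.
have a1 : (0 : rat) < a.+1%:R by rewrite ltr0n.
have := weighted_AGM n (t := a%:R / a.+1%:R) (divr_ge0 (ltW ar0) (ltW a1)).
rewrite -(ler_pM2r (exprn_gt0 n.+1 a1)) -[X in _ <= X]exprMn.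
have -> : (1 + n%:R * (a%:R / a.+1%:R)) * a.+1%:R = n.+1%:R * a%:R + 1 :> rat.
  have h : a%:R / a.+1%:R * a.+1%:R = a%:R :> rat by rewrite mulfVK // gt_eqF.
  by rewrite mulrDl mul1r -mulrA h -[a.+1%:R]natr1 -[n.+1%:R]natr1; ring.
have -> : n.+1%:R ^+ n.+1 * (a%:R / a.+1%:R) ^+ n * a.+1%:R ^+ n.+1 =
   n.+1%:R ^+ n.+1 * (a%:R ^+ n * a.+1%:R) :> rat.
  rewrite expr_div_n [a.+1%:R ^+ n.+1]exprSr -!mulrA; congr (_ * (_ * _)).
  by rewrite mulrA mulVf ?mul1r // expf_neq0 // gt_eqF.
move=> agm.
have lt2 : tr * (n.+1%:R * a%:R + 1) < (tr - Ty%:R) * (n.+1%:R * a.+1%:R).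
  move: lt; rewrite /ny cY -(ltr_pM2r nS) [(1 - _) * _ * _]mulrAC mulrBl mul1r.
  rewrite mulVf ?gt_eqF //.
  rewrite -[a.+1%:R]natr1; lra.
have lt3 : (tr * (n.+1%:R * a%:R + 1)) ^+ n.+1 <
    ((tr - Ty%:R) * (n.+1%:R * a.+1%:R)) ^+ n.+1.
  have nn : 0 <= tr * (n.+1%:R * a%:R + 1).
    by rewrite mulr_ge0 ?(ltW tr0) // addr_ge0 // mulr_ge0 // ltW.
  by rewrite ltrXn2r // ?nnegrE // (le_trans nn) // ltW.
have lt4 : tr ^+ n.+1 * (n.+1%:R ^+ n.+1 * (a%:R ^+ n * a.+1%:R)) <
    ((tr - Ty%:R) * (n.+1%:R * a.+1%:R)) ^+ n.+1.
  apply: le_lt_trans lt3; rewrite [leRHS]exprMn.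
  by rewrite ler_wpM2l // exprn_ge0 // ltW.
have pos : 0 < n.+1%:R ^+ n.+1 * a.+1%:R :> rat by rewrite mulr_gt0 ?exprn_gt0.
rewrite -(ltr_pM2l pos); move: lt4.
rewrite ![((tr - _) * _) ^+ _]exprMn [(n.+1%:R * _) ^+ _]exprMn [a.+1%:R ^+ n.+1]exprS.
set A := n.+1%:R ^+ n.+1; set B := tr ^+ n.+1; set C := (tr - _) ^+ _.
set D := a%:R ^+ n; set E := a.+1%:R ^+ n.
have -> : B * (A * (D * a.+1%:R)) = A * a.+1%:R * (B * D) by ring.
by have -> : C * (A * (a.+1%:R * E)) = A * a.+1%:R * (C * E) by ring.
Qed.

Let G := (q2 * H * n.+1)%N.
(** A normalised count is trivially at most q2 H. With this choice of [G], discarding the pairs of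
    [Hv] costs a good [y] at most |X|/(n+1) of its degree, as much as [min_degree] already loses. *)
Definition good : {set J} :=
  [set y in Y | #|[set x in X | (x, y) \in Hv]| * G <= #|X|]%N.

Lemma good_sub : good \subset Y.
Proof. by apply/subsetP => y; rewrite inE => /andP[]. Qed.

Lemma good_degree y : y \in good ->
  (1 - 2 / n.+1%:R) * #|X|%:R <= \sum_(x in X) dens x y.
Proof.
rewrite inE => /andP[yY hG].
have nS : (0 : rat) < n.+1%:R by rewrite ltr0n.
have q0 : 0 < q2%:R :> rat by rewrite ltr0n.
have HR : 0 < H%:R :> rat by rewrite ltr0n; lia.
pose bad := [set x in X | (x, y) \in Hv].
have split_dens x : x \in X -> (d x y)%:R * (nx * ny) / tr <=
   dens x y + (x \in bad)%:R * (nz * (nx * ny) / tr).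
  move=> xX; rewrite /dens inE xX /=; case: ifP => _; last by rewrite mul0r addr0.
  rewrite add0r mul1r ler_pM2r ?invr_gt0 // ler_pM2r ?mulr_gt0 // ler_nat.
  rewrite /d -sum1_card; apply: leq_sum => z _; exact: leq_b1.
have := le_trans (min_degree yY) (ler_sum _ split_dens).
rewrite big_split /= -mulr_suml.
have -> : \sum_(x in X) (x \in bad)%:R = #|bad|%:R :> rat.
  rewrite -sum1_card natr_sum big_mkcond [RHS]big_mkcond /=; apply: eq_bigr => x _.
  by rewrite inE; case: (x \in X) => //=; case: (_ \in Hv).
have bad_le : #|bad|%:R * (nz * (nx * ny) / tr) <= nx / n.+1%:R.
  have h1 : nz * (nx * ny) / tr <= q2%:R * H%:R.
    have p0 : 0 <= nx * ny * nz by rewrite !mulr_ge0 // ltW.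
    rewrite ler_pdivrMr //; move: denseR; lra.
  apply: le_trans (ler_wpM2l (ler0n _ _) h1) _.
  rewrite ler_pdivlMr // mulrA -!natrM ler_nat.
  by apply: leq_trans hG; rewrite /G !mulnA.
rewrite -/nx.
have -> : (1 - 2 / n.+1%:R) * nx = (1 - n.+1%:R^-1) * nx - nx / n.+1%:R by ring.
by rewrite lerBlDr => /le_trans -> //; rewrite lerD2l.
Qed.

Lemma card_bad : (#|Y :\: good| * #|X| <= #|Hv| * G)%N.
Proof.
apply: (@leq_trans (\sum_(y in Y :\: good) #|[set x in X | (x, y) \in Hv]| * G)%N).
  rewrite -sum_nat_const; apply: leq_sum => y; rewrite !inE => /andP[+ yY].
  by rewrite yY /= -ltnNge => /ltnW.
rewrite -big_distrl /= leq_mul2r; apply/orP; right.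
apply: (@leq_trans (\sum_(y : J) \sum_(x : I) ((x, y) \in Hv))%N).
  rewrite big_mkcond; apply: leq_sum => y _; case: ifP => // _.
  rewrite -sum1_card big_mkcond; apply: leq_sum => x _.
  by rewrite inE; case: (x \in X) => //=; case: (_ \in Hv).
rewrite exchange_big pair_big /= -sum1_card [leqRHS]big_mkcond /=.
by apply: leq_sum => -[x y] _ /=; case: (_ \in Hv).
Qed.

(** Serves to recover membership in a cylinder: the condition on (x, y) does not depend on which [z]
    is found. *)
Lemma dens_gt0 x y : 0 < dens x y -> exists2 z, z \in Z & T x y z.
Proof.
rewrite /dens; case: ifP => _; first by rewrite ltxx.
have [->|d0 _] := posnP (d x y); first by rewrite mul0r mul0r ltxx.
have : d x y != 0%N by rewrite -lt0n.
rewrite /d sum_nat_eq0 negb_forall => /existsP[z]; rewrite negb_imply => /andP[zZ].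
by case E : (T x y z) => // _; exists z.
Qed.

End HalfBox.

(** * Cylinder intersections contained in the predicate *)

Lemma eq_dotpE (F : finFieldType) (k : nat) (x y z : 'rV[F]_k) :
  eq_dotp x y z -> eq_dotp x z y /\ eq_dotp y z x.
Proof.
rewrite /eq_dotp => /andP[/eqP h1 /eqP h2].
by rewrite (dotpC z y) (dotpC z x) (dotpC y x) -h2 -h1 !eqxx.
Qed.

Lemma boxcount_swap (I J L : finType) (T : I -> J -> L -> bool) X Y Z :
  boxcount (fun x z y => T x y z) X Z Y = boxcount T X Y Z.
Proof. by apply: eq_bigr => x _; rewrite exchange_big. Qed.

Lemma two_div_le (R : realFieldType) (m : nat) : (200 <= m)%N ->
  0 <= (2 / m%:R : R) <= 1 / 100.
Proof.
move=> m200; have m0 : (0 : R) < m%:R by rewrite ltr0n; lia.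
have : 200%:R <= m%:R :> R by rewrite ler_nat.
by rewrite ler_pdivrMr // divr_ge0 ?(ltW m0) //=; lra.
Qed.

(** The final count, with x = |X| and W = |Y| |Z|: [c1] pairs (y, z) are allowed by the third
    cylinder, [c2] of them are well-behaved, [v] bounds the discarded ones and [hv] counts heavy
    pairs. Density forces c1, then c2, to be at least of order W/H, so t is at least of order x W /
    H^3; but t is at most 3 x W / q2. *)
Lemma density_balance (x W q2 H t c1 c2 v hv : nat) :
  (0 < x)%N -> (0 < W)%N ->
  (2 * (x * W) <= q2 * t * H)%N ->
  (q2 * t <= 2 * x * c1 + q2 * x * hv)%N ->
  (q2 * t <= 3 * (x * W))%N ->
  (8 * H * q2 * hv <= W)%N -> (c1 <= c2 + v)%N -> (8 * H * v <= 3 * W)%N ->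
  (x * c2 <= 2 * H ^ 2 * t)%N -> (9 * q2 <= 96 * H ^ 3)%N.
Proof.
move=> x0 W0 dense C1_large bb qq C1C2 v_small t_large.
have s1 : (2 * W <= 2 * H * c1 + H * q2 * hv)%N.
  rewrite -(leq_pmul2l x0).
  have := leq_trans dense (leq_mul C1_large (leqnn H)).
  have -> : (2 * (x * W) = x * (2 * W))%N by ring.
  by have -> : ((2 * x * c1 + q2 * x * hv) * H =
    x * (2 * H * c1 + H * q2 * hv))%N by ring.
have s2 : (8 * H * c1 <= 8 * H * c2 + 3 * W)%N.
  by apply: leq_trans (leq_mul (leqnn (8 * H)%N) C1C2) _; rewrite mulnDr leq_add2l.
have s3 : (9 * W <= 16 * H * c2)%N.
  by move: s1 s2 qq; rewrite -!mulnA; lia.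
have s4 : (9 * (x * W) <= 32 * H ^ 3 * t)%N.
  have := leq_mul (leqnn x) s3.
  have := leq_mul (leqnn (16 * H)%N) t_large.
  have -> : (16 * H * (x * c2) = x * (16 * H * c2))%N by ring.
  have -> : (16 * H * (2 * H ^ 2 * t) = 32 * H ^ 3 * t)%N by ring.
  have -> : (9 * (x * W) = x * (9 * W))%N by ring.
  by move=> h1 h2; apply: leq_trans h1.
have b0 : (0 < x * W)%N by rewrite muln_gt0 x0.
rewrite -(leq_pmul2r b0).
have := leq_mul (leqnn q2) s4.
have := leq_mul (leqnn (32 * H ^ 3)%N) bb.
have -> : (32 * H ^ 3 * (3 * (x * W)) = 96 * H ^ 3 * (x * W))%N by ring.
have -> : (32 * H ^ 3 * (q2 * t) = q2 * (32 * H ^ 3 * t))%N by ring.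
have -> : (q2 * (9 * (x * W)) = 9 * q2 * (x * W))%N by ring.
by move=> h1 h2; apply: leq_trans h1.
Qed.

Section Cylinder.
Variables (F : finFieldType) (k : nat).
Notation V := 'rV[F]_k.
Let q := #|F|.
Let N := #|{: V}|.
Variables (h p : nat).
Let H := (2 ^ h)%N.
Let n := (34 * p).+1.
(* Only boxes of density at least [1 / S] compete; on smaller ones the inequality
   defining [spread] already follows from the bound [H]. *)
Let S := ((2 * H ^ 2) ^ n.+1)%N.

Hypothesis k_ge : (14 <= k)%N.
Hypothesis h_gt0 : (0 < h)%N.
Hypothesis p_ge : (6 <= p)%N.
Hypothesis p_even : ~~ odd p.
Hypothesis pH : (56 * H ^ 2 <= 2 ^ p)%N.
Hypothesis qS : (S <= q)%N.

Let H_ge2 : (2 <= H)%N.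
Proof. by rewrite /H -[leqLHS]expn1 leq_pexp2l. Qed.
Let S_geX (m : nat) : (m <= n.+1)%N -> ((2 * H ^ 2) ^ m <= S)%N.
Proof. by move=> mn; rewrite /S leq_pexp2l // muln_gt0 expn_gt0; lia. Qed.
Let H8 : (8 <= 2 * H ^ 2)%N.
Proof. by rewrite (leq_mul2l 2 4) (leq_sqr 2). Qed.
Let qH : (H ^ 2 <= q)%N.
Proof.
apply: leq_trans qS; apply: leq_trans (S_geX (_ : 1 <= n.+1)%N) => //.
by rewrite expn1; lia.
Qed.
Let q40 : (40 <= q)%N.
Proof.
apply: leq_trans qS; apply: leq_trans (S_geX (_ : 2 <= n.+1)%N) => //.
by apply: (@leq_trans (8 ^ 2)) => //; rewrite leq_sqr.
Qed.
Let qn : (n.+1 <= q)%N.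
Proof.
apply: leq_trans qS; rewrite ltnW //.
apply: (@leq_trans (2 ^ n.+1)%N); first exact: ltn_expl.
by rewrite leq_exp2r //; lia.
Qed.
Let n_ge : (200 <= n.+1)%N. Proof. by rewrite /n; lia. Qed.
Let q_large : ~~ (9 * q ^ 2 <= 96 * H ^ 3)%N.
Proof.
have s6 : (H ^ 3 <= q)%N.
  apply: leq_trans qS; apply: leq_trans (S_geX (_ : 2 <= n.+1)%N) => //.
  have -> : ((2 * H ^ 2) ^ 2 = H ^ 3 * (4 * H))%N by ring.
  by rewrite leq_pmulr // muln_gt0 (ltnW H_ge2).
have : (40 * H ^ 3 <= q ^ 2)%N by apply: leq_mul.
have : (0 < H ^ 3)%N by rewrite expn_gt0 (ltnW H_ge2).
rewrite -ltnNge; move: (H ^ 3)%N (q ^ 2)%N => a b; lia.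
Qed.
Let S_gt0 : (0 < S)%N. Proof. by rewrite expn_gt0; lia. Qed.
Let q_gt0 : (0 < q)%N. Proof. lia. Qed.
Let NE : N = (q ^ k)%N. Proof. by rewrite /N card_mx mul1n. Qed.
Let N_gt0 : (0 < N)%N. Proof. by rewrite NE expn_gt0 q_gt0. Qed.
Let HB := (5 * q ^ 6 * S ^ 2 * N)%N.
Let G := (q ^ 2 * H * n.+1)%N.

(** Each of 40, H^2, n+1 and [S] is at most [q], so the left side is at most q^14 N. Hence the
    requirement k >= 14. *)
Let key : (8 * H * G * HB * S <= N ^ 2)%N.
Proof.
have -> : (8 * H * G * HB * S = 40 * H ^ 2 * n.+1 * S ^ 3 * q ^ 8 * N)%N.
  by rewrite /G /HB; ring.
rewrite expnS expn1; apply: leq_mul => //.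
apply: (@leq_trans (q * q * q * q ^ 3 * q ^ 8)%N).
  by do 4!(apply: leq_mul => //); rewrite leq_exp2r.
have -> : (q * q * q * q ^ 3 * q ^ 8 = q ^ 14)%N by ring.
by rewrite NE leq_pexp2l.
Qed.

(** Heavy pairs are negligible on a competing box: if [b] is the product of two sides and [a] the
    third, then b >= N^2 / S. *)
Let keyZ (Z : {set V}) (a b : nat) :
  (a <= N)%N -> (0 < b)%N -> (N ^ 3 <= b * a * S)%N -> (0 < #|Z|)%N ->
  (N <= #|Z| * S)%N -> (8 * H * G * #|heavy Z| <= b)%N.
Proof.
move=> aN b0 bS Z0 ZS; have hv := card_heavy Z0 ZS.
rewrite -(leq_pmul2r S_gt0).
apply: (@leq_trans (N ^ 2)).
  apply: leq_trans key; rewrite leq_mul2r; apply/orP; right.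
  by rewrite leq_mul2l; apply/orP; right.
rewrite -(leq_pmul2r N_gt0) -expnSr; apply: leq_trans bS _.
by rewrite mulnAC leq_mul2l aN orbT.
Qed.

Definition inside (T : V -> V -> V -> bool) :=
  forall x y z, T x y z -> eq_dotp x y z.

Lemma heavyP (T : V -> V -> V -> bool) (Z : {set V}) x y : inside T ->
  (x, y) \notin heavy Z -> (q ^ 2 * \sum_(z in Z) T x y z <= 2 * #|Z|)%N.
Proof.
move=> TD; rewrite inE /= -leqNgt; apply: leq_trans; rewrite leq_mul2l.
apply/orP; right; rewrite -sum1_card big_mkcond [leqRHS]big_mkcond /=.
apply: leq_sum => z _; rewrite inE; case: (z \in Z) => //=.
by case E: (T x y z) => //; rewrite (TD _ _ _ E).
Qed.

Lemma side_large (a b c : nat) : (a <= N)%N -> (b <= N)%N ->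
  (N ^ 3 <= a * b * c * S)%N -> (N <= c * S)%N.
Proof.
move=> aN bN; have N2 : (0 < N ^ 2)%N by rewrite expn_gt0 N_gt0.
move=> large; rewrite -(leq_pmul2l N2) -expnSr; apply: leq_trans large _.
by rewrite -mulnA leq_mul2r expnS expn1 leq_mul ?orbT.
Qed.

(** Of the constant 3, the pairs that are not heavy account for 2 and the heavy ones for 1. *)
Lemma box_bound (T : V -> V -> V -> bool) (X Y Z : {set V}) : inside T ->
  (N ^ 3 <= #|X| * #|Y| * #|Z| * S)%N ->
  (q ^ 2 * boxcount T X Y Z <= 3 * (#|X| * #|Y| * #|Z|))%N.
Proof.
move=> TD large.
have ZS : (N <= #|Z| * S)%N by apply: side_large large; apply: max_card.
have N3 : (0 < N ^ 3)%N by rewrite expn_gt0 N_gt0.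
have b0 : (0 < #|X| * #|Y| * #|Z|)%N.
  by move: (leq_trans N3 large); rewrite muln_gt0 => /andP[].
have [XY0 Z0] : (0 < #|X| * #|Y|)%N /\ (0 < #|Z|)%N.
  by move: b0; rewrite muln_gt0 => /andP[].
have hv : (q ^ 2 * #|heavy Z| <= #|X| * #|Y|)%N.
  apply: leq_trans (keyZ (max_card (mem Z)) XY0 large Z0 ZS).
  rewrite leq_mul2r; apply/orP; right.
  have -> : (8 * H * G = q ^ 2 * (8 * H * H * n.+1))%N by rewrite /G; ring.
  by rewrite leq_pmulr // !muln_gt0 (ltnW H_ge2).
apply: (@leq_trans (\sum_(x in X) \sum_(y in Y)
    (2 * #|Z| + q ^ 2 * #|Z| * ((x, y) \in heavy Z)))%N).
  rewrite /boxcount big_distrr /=; apply: leq_sum => x _.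
  rewrite big_distrr /=; apply: leq_sum => y _.
  case: (boolP ((x, y) \in heavy Z)) => [_|/(heavyP TD) hxy]; last first.
    by rewrite muln0 addn0.
  rewrite muln1; apply: leq_trans (leq_addl _ _); rewrite leq_mul2l.
  by apply/orP; right; rewrite -sum1_card; apply: leq_sum => z _; apply: leq_b1.
under eq_bigr => x _ do rewrite big_split /= sum_nat_const -big_distrr /=.
rewrite big_split /= sum_nat_const -big_distrr /=.
have cnt : (\sum_(x in X) \sum_(y in Y) ((x, y) \in heavy Z) <= #|heavy Z|)%N.
  rewrite pair_big /= -sum1_card big_mkcond [leqRHS]big_mkcond /=.
  by apply: leq_sum => -[x y] _ /=; case: ifP => _; case: ifP.
have : (q ^ 2 * #|Z| * \sum_(x in X) \sum_(y in Y) ((x, y) \in heavy Z) <=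
    #|X| * #|Y| * #|Z|)%N.
  apply: (@leq_trans (q ^ 2 * #|Z| * #|heavy Z|)%N); first by rewrite leq_mul2l cnt orbT.
  by rewrite mulnAC leq_mul2r hv orbT.
move=> hh; have := leq_add (leqnn (#|X| * (#|Y| * (2 * #|Z|)))%N) hh.
by move/leq_trans; apply; apply: eq_leq; ring.
Qed.

Lemma maximal_box (T : V -> V -> V -> bool) :
  exists X Y Z : {set V}, (N ^ 3 <= #|X| * #|Y| * #|Z| * S)%N /\
    forall X' Y' Z' : {set V}, (N ^ 3 <= #|X'| * #|Y'| * #|Z'| * S)%N ->
    (boxcount T X' Y' Z' ^ n.+1 * (#|X| * #|Y| * #|Z|) ^ n <=
       boxcount T X Y Z ^ n.+1 * (#|X'| * #|Y'| * #|Z'|) ^ n)%N.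
Proof.
pose vol (b : {set V} * {set V} * {set V}) := (#|b.1.1| * #|b.1.2| * #|b.2|)%N.
pose cnt (b : {set V} * {set V} * {set V}) := boxcount T b.1.1 b.1.2 b.2.
pose f b : rat := (cnt b)%:R ^+ n.+1 / (vol b)%:R ^+ n.
have b0P : (N ^ 3 <= vol (setT, setT, setT) * S)%N.
  rewrite /vol /= !cardsT -/N; apply: leq_trans (leq_pmulr _ S_gt0).
  by apply: eq_leq; ring.
case: (@arg_maxP _ _ _ _ (fun b => N ^ 3 <= vol b * S)%N f b0P).
move=> [[X Y] Z] /= bP bmax; exists X, Y, Z; split=> // X' Y' Z' b'P.
have vol_gt0 b : (N ^ 3 <= vol b * S)%N -> (0 : rat) < (vol b)%:R ^+ n.
  have N3 : (0 < N ^ 3)%N by rewrite expn_gt0 N_gt0.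
  by move=> /(leq_trans N3); rewrite muln_gt0 => /andP[v0 _]; rewrite exprn_gt0 // ltr0n.
have := bmax (X', Y', Z') b'P; rewrite /f.
rewrite ler_pdivrMr; last exact: (vol_gt0 (X', Y', Z')).
rewrite mulrAC ler_pdivlMr; last exact: (vol_gt0 (X, Y, Z)).
by rewrite -!natrX -!natrM ler_nat.
Qed.

Section Contradiction.
Variables A B C : V -> V -> bool.
Let T x y z := [&& A x y, B x z & C y z].
Hypothesis TD : inside T.
Hypothesis T_large : (2 * N ^ 3 <= q ^ 2 * boxcount T setT setT setT * H)%N.

Lemma no_large_cylinder : False.
Proof.
have [X [Y [Z [large bmax]]]] := maximal_box T.
set t := boxcount T X Y Z in bmax.
pose b := (#|X| * #|Y| * #|Z|)%N.
have N3 : (0 < N ^ 3)%N by rewrite expn_gt0 N_gt0.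
have b0 : (0 < b)%N by move: (leq_trans N3 large); rewrite muln_gt0 => /andP[].
have [/andP[X0 Y0] Z0] : ((0 < #|X|) && (0 < #|Y|))%N /\ (0 < #|Z|)%N.
  by move: b0; rewrite /b !muln_gt0 => /andP[].
have bN : (b <= N ^ 3)%N.
  have -> : (N ^ 3 = N * N * N)%N by ring.
  by rewrite /b !leq_mul ?max_card.
have bb : (q ^ 2 * t <= 3 * b)%N by apply: box_bound.
pose T0 := boxcount T setT setT setT.
have m0 : (T0 ^ n.+1 * b ^ n <= t ^ n.+1 * (N ^ 3) ^ n)%N.
  have := bmax setT setT setT; rewrite !cardsT -/N.
  have -> : (N * N * N = N ^ 3)%N by ring.
  by apply; rewrite leq_pmulr.
(* Since b <= N^3, maximality against the whole space shows that [T] is at least as dense on the box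
   as overall. *)
have dense : (2 * b <= q ^ 2 * t * H)%N.
  have T0b : (T0 * b <= t * N ^ 3)%N.
    rewrite -(@leq_exp2r _ _ n.+1) // [((T0 * b) ^ _)%N]expnMn [((t * _) ^ _)%N]expnMn.
    rewrite [(b ^ _)%N]expnSr mulnA.
    by apply: leq_trans (leq_mul m0 bN) _; rewrite -mulnA -expnSr.
  rewrite -(leq_pmul2r N3).
  have : (2 * N ^ 3 * b <= q ^ 2 * T0 * H * b)%N.
    by rewrite leq_mul2r [(_ <= _ * H)%N]T_large orbT.
  have : (q ^ 2 * H * (T0 * b) <= q ^ 2 * H * (t * N ^ 3))%N.
    by rewrite leq_mul2l T0b orbT.
  move=> h1 h2; rewrite mulnAC; apply: leq_trans h2 _.
  have -> : (q ^ 2 * T0 * H * b = q ^ 2 * H * (T0 * b))%N by ring.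
  apply: leq_trans h1 _; apply: eq_leq; ring.
(* The density of [T] is at least 2/(q^2 H) overall and at most 3/q^2 on the box. Maximality then
   bounds N^3 / b by (3H/2)^(n+1). *)
have largeH : (N ^ 3 <= b * (2 * H) ^ n.+1)%N.
  have h1 : ((2 * N ^ 3) ^ n.+1 <= (q ^ 2 * H) ^ n.+1 * T0 ^ n.+1)%N.
    by rewrite -expnMn leq_exp2r // mulnAC.
  have h2 : ((q ^ 2 * H) ^ n.+1 * t ^ n.+1 <= (3 * H * b) ^ n.+1)%N.
    rewrite -expnMn leq_exp2r //.
    have -> : (q ^ 2 * H * t = H * (q ^ 2 * t))%N by ring.
    by apply: leq_trans (leq_mul (leqnn H) bb) _; apply: eq_leq; ring.
  have bn0 : (0 < b ^ n)%N by rewrite expn_gt0 b0.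
  have Nn0 : (0 < (N ^ 3) ^ n)%N by rewrite expn_gt0 N3.
  have h3 : ((2 * N ^ 3) ^ n.+1 * b ^ n <= (3 * H * b) ^ n.+1 * (N ^ 3) ^ n)%N.
    apply: leq_trans (leq_mul h1 (leqnn _)) _; rewrite -mulnA.
    apply: leq_trans (leq_mul (leqnn _) m0) _; rewrite mulnA.
    exact: leq_mul.
  have h4 : (2 ^ n.+1 * N ^ 3 <= (3 * H) ^ n.+1 * b)%N.
    rewrite -(leq_pmul2r bn0) -(leq_pmul2r Nn0).
    move: h3; rewrite [((2 * _) ^ n.+1)%N]expnMn [((3 * H * b) ^ n.+1)%N]expnMn.
    rewrite [((3 * H) ^ n.+1)%N]expnMn [((N ^ 3) ^ n.+1)%N]expnSr [(b ^ n.+1)%N]expnSr.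
    set a1 := (2 ^ _)%N; set a2 := ((N ^ 3) ^ n)%N; set a3 := (b ^ n)%N.
    set a4 := (3 ^ _)%N; set a5 := (H ^ _)%N; set a6 := (N ^ 3)%N.
    have -> : (a1 * (a2 * a6) * a3 = a1 * a6 * a3 * a2)%N by ring.
    by have -> : (a4 * a5 * (a3 * b) * a2 = a4 * a5 * b * a3 * a2)%N by ring.
  have p2 : (0 < 2 ^ n.+1)%N by rewrite expn_gt0.
  rewrite -(leq_pmul2l p2); apply: leq_trans h4 _; rewrite mulnC mulnCA.
  by rewrite leq_mul2l -expnMn leq_exp2r //; apply/orP; right; lia.
have XS : (N <= #|X| * S)%N.
  apply: (@side_large #|Y| #|Z|); rewrite ?max_card //; move: large.
  by rewrite [(#|Y| * _ * _)%N]mulnC mulnA.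
have YS : (N <= #|Y| * S)%N.
  apply: (@side_large #|X| #|Z|); rewrite ?max_card //; move: large.
  by rewrite [(#|X| * #|Z| * _)%N]mulnAC.
have ZS : (N <= #|Z| * S)%N by apply: (@side_large #|X| #|Y|); rewrite ?max_card.
pose W := (#|Y| * #|Z|)%N.
have W0 : (0 < W)%N by rewrite muln_gt0 Y0.
(* The predicate is symmetric, so all bounds on heavy pairs are available for each choice of the
   counted coordinate. *)
pose T2 x z y := T x y z.
pose T3 y z x := T x y z.
have T2D : inside T2 by move=> x z y /TD /eq_dotpE[].
have T3D : inside T3 by move=> y z x /TD /eq_dotpE[].
have hvZ : (8 * H * G * #|heavy Z| <= #|X| * #|Y|)%N.
  by apply: (@keyZ _ #|Z|); rewrite ?max_card ?muln_gt0 ?X0.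
have hvY : (8 * H * G * #|heavy Y| <= #|X| * #|Z|)%N.
  apply: (@keyZ _ #|Y|); rewrite ?max_card ?muln_gt0 ?X0 //.
  by rewrite [(_ * _ * #|Y|)%N]mulnAC.
have hvX : (8 * H * G * #|heavy X| <= W)%N.
  apply: (@keyZ _ #|X|); rewrite ?max_card //.
  by rewrite [(_ * #|X|)%N]mulnC /W mulnA.
have max1 (U : {set V}) (U' : {set V}) : U \subset X -> U' \subset Y ->
    (N ^ 3 <= #|U| * #|U'| * #|Z| * S)%N ->
    (boxcount T U U' Z ^ n.+1 * (#|X| * #|Y|) ^ n <=
       t ^ n.+1 * (#|U| * #|U'|) ^ n)%N.
  move=> _ _ /bmax; rewrite [((#|X| * _ * _) ^ _)%N]expnMn mulnA.
  by rewrite [((_ * #|Z|) ^ _)%N]expnMn mulnA leq_pmul2r // expn_gt0 Z0.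
have t2E : boxcount T2 X Z Y = t by rewrite /T2 boxcount_swap.
have max2 (U : {set V}) (U' : {set V}) : U \subset X -> U' \subset Z ->
    (N ^ 3 <= #|U| * #|U'| * #|Y| * S)%N ->
    (boxcount T2 U U' Y ^ n.+1 * (#|X| * #|Z|) ^ n <=
       boxcount T2 X Z Y ^ n.+1 * (#|U| * #|U'|) ^ n)%N.
  rewrite t2E /T2 boxcount_swap [(#|U| * _ * _)%N]mulnAC => _ _ /bmax.
  rewrite [(#|X| * _ * _)%N]mulnAC [(#|U| * _ * _)%N]mulnAC.
  rewrite [((#|X| * _ * _) ^ _)%N]expnMn mulnA.
  by rewrite [((_ * #|Y|) ^ _)%N]expnMn mulnA leq_pmul2r // expn_gt0 Y0.
have largeH2 : (N ^ 3 <= #|X| * #|Z| * #|Y| * (2 * H) ^ n.+1)%N.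
  by rewrite [(#|X| * _ * _)%N]mulnAC.
have dense2 : (2 * (#|X| * #|Z| * #|Y|) <= q ^ 2 * boxcount T2 X Z Y * H)%N.
  by rewrite t2E [(#|X| * _ * _)%N]mulnAC.
have hP1 x y : (x, y) \notin heavy Z ->
    (q ^ 2 * \sum_(z in Z) T x y z <= 2 * #|Z|)%N by apply: heavyP.
have hP2 x z : (x, z) \notin heavy Y ->
    (q ^ 2 * \sum_(y in Y) T2 x z y <= 2 * #|Y|)%N by apply: heavyP.
pose r := dens T X Y Z (heavy Z).
pose s := dens T2 X Z Y (heavy Y).
have rS : spread n H%:R X Y r := dens_spread N3 H_ge2 erefl max1 largeH dense hP1.
have sS : spread n H%:R X Z s := dens_spread N3 H_ge2 erefl max2 largeH2 dense2 hP2.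
pose Yg := good X Y (heavy Z) n H (q ^ 2).
pose Zg := good X Z (heavy Y) n H (q ^ 2).
have degr y : y \in Yg -> (1 - 2 / n.+1%:R) * #|X|%:R <= \sum_(x in X) r x y.
  exact: (good_degree N3 H_ge2 erefl max1 largeH dense).
have degs y : y \in Zg -> (1 - 2 / n.+1%:R) * #|X|%:R <= \sum_(x in X) s x y.
  exact: (good_degree N3 H_ge2 erefl max2 largeH2 dense2).
have H1 : 1 <= H%:R :> rat by rewrite ler1n; lia.
have p0 : (0 < p)%N by lia.
have c01 : 0 <= (2 / n.+1%:R : rat) <= 1 / 100.
  exact: two_div_le.
have mix := spread_mixing p0 p_even H1 c01 X0 Y0 Z0 rS sS
  (good_sub _ _ _ _ _ _) (good_sub _ _ _ _ _ _) degr degs.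
set E := [set yz in _ | _] in mix.
(* The constant in [pH] is 56 H^2 = 7H * 8H, the first factor coming from [spread_mixing]. *)
have E_small : (8 * H * #|E| <= W)%N.
  have : (#|E| * 2 ^ p <= 7 * H * W)%N.
    by rewrite -(ler_nat rat) !natrM natrX.
  have : (#|E| * (56 * H ^ 2) <= #|E| * 2 ^ p)%N by rewrite leq_mul2l pH orbT.
  move=> h1 /(leq_trans h1).
  have -> : (#|E| * (56 * H ^ 2) = 7 * H * (8 * H * #|E|))%N by ring.
  by rewrite leq_pmul2l // muln_gt0 (ltnW H_ge2).
have badY : (8 * H * #|Y :\: Yg| <= #|Y|)%N.
  rewrite -(leq_pmul2r X0) -mulnA.
  apply: leq_trans (leq_mul (leqnn _) (card_bad _ _ _ _ _ _)) _.
  rewrite [(#|Y| * _)%N]mulnC; apply: leq_trans hvZ.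
  by apply: eq_leq; rewrite /G; ring.
have badZ : (8 * H * #|Z :\: Zg| <= #|Z|)%N.
  rewrite -(leq_pmul2r X0) -mulnA.
  apply: leq_trans (leq_mul (leqnn _) (card_bad _ _ _ _ _ _)) _.
  rewrite [(#|Z| * _)%N]mulnC; apply: leq_trans hvY.
  by apply: eq_leq; rewrite /G; ring.
pose C1 := [set yz in setX Y Z | C yz.1 yz.2].
(* The allowed pairs with both ends good and a mixed codegree above |X|/2. *)
pose C2 := (C1 :&: setX Yg Zg) :\: E.
pose e (yz : V * V) := (\sum_(x in X) T x yz.1 yz.2)%N.
have tE : t = (\sum_(yz in C1) e yz)%N.
  rewrite /t /boxcount; under eq_bigr => x _ do rewrite pair_big /=.
  rewrite exchange_big /= big_mkcond [RHS]big_mkcond /=; apply: eq_bigr => -[y z] _.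
  rewrite !inE /=; case: (y \in Y); case: (z \in Z) => //=.
  case Cyz: (C y z) => //.
  by apply: big1 => x _; rewrite /T Cyz !andbF.
(* A pair that is not heavy carries at most 2|X|/q^2 points, so a large [t] needs many allowed
   pairs. *)
have C1_large : (q ^ 2 * t <= 2 * #|X| * #|C1| + q ^ 2 * #|X| * #|heavy X|)%N.
  apply: (@leq_trans (\sum_(yz in C1)
      (2 * #|X| + q ^ 2 * #|X| * (yz \in heavy X)))%N).
    rewrite tE big_distrr /=; apply: leq_sum => -[y z] _.
    case: (boolP ((y, z) \in heavy X)) => [_|/(heavyP T3D) hyz]; last first.
      by rewrite muln0 addn0.
    rewrite muln1; apply: leq_trans (leq_addl _ _); rewrite leq_mul2l.
    by apply/orP; right; rewrite -sum1_card; apply: leq_sum => x _; apply: leq_b1.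
  rewrite big_split /= sum_nat_const mulnC leq_add2l -big_distrr leq_mul2l /=.
  apply/orP; right; rewrite -sum1_card big_mkcond [leqRHS]big_mkcond /=.
  by apply: leq_sum => yz _; case: ifP => _; case: ifP.
(* A nonzero term r s of the codegree is at most H^2 and certifies the first two cylinders at [x];
   the third holds as the pair lies in C1. *)
have e_large yz : yz \in C2 -> (#|X| <= 2 * H ^ 2 * e yz)%N.
  case: yz => y z; rewrite in_setD in_setI => /andP[nE /andP[C1yz YZg]].
  have Cyz : C y z by move: C1yz; rewrite inE => /andP[].
  have K12 : #|X|%:R / 2 < \sum_(x in X) r x y * s x z.
    by move: nE; rewrite inE YZg /= -ltNge.
  rewrite -(ler_nat rat) !natrM.
  have : \sum_(x in X) r x y * s x z <= H%:R ^+ 2 * (e (y, z))%:R.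
    rewrite /e /= natr_sum mulr_sumr; apply: ler_sum => x _.
    have /andP[r0 rH] := rS.1 x y; have /andP[s0 sH] := sS.1 x z.
    have [r_eq|rx] := eqVneq (r x y) 0; first by rewrite r_eq mul0r mulr_ge0 ?exprn_ge0.
    have [s_eq|sx] := eqVneq (s x z) 0; first by rewrite s_eq mulr0 mulr_ge0 ?exprn_ge0.
    have [z' _ /and3P[Axy _ _]] : exists2 z', z' \in Z & T x y z'.
      by apply: (@dens_gt0 _ _ _ T X Y Z (heavy Z)); rewrite lt_def rx.
    have [y' _ /and3P[_ Bxz _]] : exists2 y', y' \in Y & T2 x z y'.
      by apply: (@dens_gt0 _ _ _ T2 X Z Y (heavy Y)); rewrite lt_def sx.
    by rewrite /T Axy Bxz Cyz mulr1 expr2 ler_pM.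
  move=> le; have := lt_le_trans K12 le; rewrite ltr_pdivrMr // => /ltW /le_trans.
  by apply; apply: eq_ler; ring.
have t_large : (#|X| * #|C2| <= 2 * H ^ 2 * t)%N.
  rewrite tE big_distrr /=.
  apply: (@leq_trans (\sum_(yz in C2) 2 * H ^ 2 * e yz)%N).
    by rewrite mulnC -sum_nat_const; apply: leq_sum.
  rewrite big_mkcond [leqRHS]big_mkcond /=; apply: leq_sum => yz _.
  by rewrite in_setD in_setI; case: (yz \in C1); rewrite ?andbF //=; case: ifP.
have C1C2 : (#|C1| <= #|C2| + (#|E| + #|Y :\: Yg| * #|Z| + #|Y| * #|Z :\: Zg|))%N.
  rewrite -!cardsX.
  apply: leq_trans (leq_add (leqnn _) (leq_add (leq_card_setU _ _) (leqnn _))).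
  apply: leq_trans (leq_add (leqnn _) (leq_card_setU _ _)).
  apply: leq_trans (leq_card_setU _ _).
  apply: subset_leq_card; apply/subsetP => -[y z].
  rewrite in_setU in_setD in_setI in_setU in_setU => yzC1; rewrite yzC1 /=.
  case: (_ \in E) => //=.
  have : (y, z) \in setX Y Z by move: yzC1; rewrite inE => /andP[].
  rewrite !in_setX !in_setD => /andP[-> ->] /=; rewrite !andbT.
  by case: (y \in Yg); case: (z \in Zg).
have qq : (8 * H * q ^ 2 * #|heavy X| <= W)%N.
  apply: leq_trans hvX; rewrite leq_mul2r; apply/orP; right.
  by rewrite leq_mul2l /G -mulnA leq_pmulr ?orbT // muln_gt0 (ltnW H_ge2).
have bE : b = (#|X| * W)%N by rewrite /b /W mulnA.
have v_small : (8 * H * (#|E| + #|Y :\: Yg| * #|Z| + #|Y| * #|Z :\: Zg|) <= 3 * W)%N.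
  rewrite !mulnDr; have -> : (3 * W = W + W + W)%N by ring.
  apply: leq_add; first apply: leq_add => //.
    by rewrite mulnA leq_mul2r badY orbT.
  by rewrite mulnCA leq_mul2l badZ orbT.
rewrite bE in dense bb.
have := density_balance X0 W0 dense C1_large bb qq C1C2 v_small t_large.
exact/negP.
Qed.

End Contradiction.
End Cylinder.

(** * Protocols and cylinder intersections *)

Section CylinderCover.
Variables X Y Z : Type.

Definition cylinder : Type := (X -> Y -> bool) * (X -> Z -> bool) * (Y -> Z -> bool).

Definition in_cylinder (c : cylinder) x y z : bool :=
  [&& c.1.1 x y, c.1.2 x z & c.2 y z].

(** One cylinder intersection per accepting leaf: the inputs whose run ends there. *)
Fixpoint cylinders (P : nof_protocol X Y Z) : seq cylinder :=
  match P with
  | Output b => if b then [:: (fun _ _ => true, fun _ _ => true, fun _ _ => true)] else [::]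
  | Speak1 f P1 P0 =>
      [seq (c.1, fun y z => f y z && c.2 y z) | c <- cylinders P1] ++
      [seq (c.1, fun y z => ~~ f y z && c.2 y z) | c <- cylinders P0]
  | Speak2 f P1 P0 =>
      [seq (c.1.1, fun x z => f x z && c.1.2 x z, c.2) | c <- cylinders P1] ++
      [seq (c.1.1, fun x z => ~~ f x z && c.1.2 x z, c.2) | c <- cylinders P0]
  | Speak3 f P1 P0 =>
      [seq (fun x y => f x y && c.1.1 x y, c.1.2, c.2) | c <- cylinders P1] ++
      [seq (fun x y => ~~ f x y && c.1.1 x y, c.1.2, c.2) | c <- cylinders P0]
  end.

Lemma nof_run_cylinders (P : nof_protocol X Y Z) x y z :
  nof_run P x y z = has (fun c => in_cylinder c x y z) (cylinders P).
Proof.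
have has_and (s : seq cylinder) g (b : bool) :
    (forall c, in_cylinder (g c) x y z = b && in_cylinder c x y z) ->
    has (fun c => in_cylinder c x y z) (map g s) =
    b && has (fun c => in_cylinder c x y z) s.
  move=> gb; rewrite has_map (eq_has gb).
  by case: b {gb} => //=; rewrite has_pred0.
elim: P => [[]|f P1 IH1 P0 IH0|f P1 IH1 P0 IH0|f P1 IH1 P0 IH0] //=;
  rewrite has_cat IH1 IH0.
- rewrite (has_and _ _ (f y z)); last first.
    by move=> c; rewrite /in_cylinder /=; case: (f y z); rewrite ?andbF.
  rewrite (has_and _ _ (~~ f y z)); last first.
    by move=> c; rewrite /in_cylinder /=; case: (f y z); rewrite ?andbF.
  by case: (f y z); rewrite ?orbF.
- rewrite (has_and _ _ (f x z)); last first.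
    by move=> c; rewrite /in_cylinder /=; case: (f x z); rewrite ?andbF.
  rewrite (has_and _ _ (~~ f x z)); last first.
    by move=> c; rewrite /in_cylinder /=; case: (f x z); rewrite ?andbF.
  by case: (f x z); rewrite ?orbF.
- rewrite (has_and _ _ (f x y)); last first.
    by move=> c; rewrite /in_cylinder /= -andbA.
  rewrite (has_and _ _ (~~ f x y)); last first.
    by move=> c; rewrite /in_cylinder /= -andbA.
  by case: (f x y); rewrite ?orbF.
Qed.

Lemma size_cylinders (P : nof_protocol X Y Z) :
  (size (cylinders P) <= 2 ^ nof_cost P)%N.
Proof.
have step (a b c d : nat) : (a <= 2 ^ c -> b <= 2 ^ d -> a + b <= 2 ^ (maxn c d).+1)%N.
  move=> ac bd; rewrite expnS mul2n -addnn leq_add //.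
    by apply: leq_trans ac _; rewrite leq_pexp2l // leq_maxl.
  by apply: leq_trans bd _; rewrite leq_pexp2l // leq_maxr.
by elim: P => [[]|f P1 IH1 P0 IH0|f P1 IH1 P0 IH0|f P1 IH1 P0 IH0] //=;
  rewrite size_cat !size_map step.
Qed.

End CylinderCover.

Lemma det_nondet (X Y Z : finType) (D : X -> Y -> Z -> bool) c :
  det_within D c -> nondet_within D c.
Proof.
case=> P [Pc PD]; exists 0%N, (fun=> P); split=> // x y z.
by rewrite -PD; split=> [?|[]//]; exists [tuple].
Qed.

(** The 2^m witnesses contribute at most 2^(c - m) accepting leaves each. *)
Lemma nondet_cylinders (X Y Z : finType) (D : X -> Y -> Z -> bool) c :
  nondet_within D c -> exists2 s : seq (cylinder X Y Z), (size s <= 2 ^ c)%N &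
    forall x y z, D x y z = has (fun c => in_cylinder c x y z) s.
Proof.
case=> m [P [Pc PD]].
exists (flatten [seq cylinders (P w) | w <- enum {: m.-tuple bool}]).
  have mc : (m <= c)%N by apply: leq_trans (leq_addr _ _) (Pc [tuple of nseq m true]).
  rewrite size_flatten /shape -map_comp sumnE big_map big_enum /=.
  apply: (@leq_trans (\sum_(w : m.-tuple bool) 2 ^ (c - m))%N).
    apply: leq_sum => w _; apply: leq_trans (size_cylinders _) _.
    by rewrite leq_pexp2l // leq_subRL.
  by rewrite sum_nat_const card_tuple card_bool -expnD subnKC.
move=> x y z; apply/idP/hasP => [/PD[w]|[c0 /flattenP[s /mapP[w _ ->] cs] inc]].
  rewrite nof_run_cylinders => /hasP[c0 c0w inc]; exists c0 => //.
  by apply/flattenP; exists (cylinders (P w)) => //; apply: map_f; rewrite mem_enum.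
by apply/PD; exists w; rewrite nof_run_cylinders; apply/hasP; exists c0.
Qed.

Section LowerBound.
Variables (F : finFieldType) (k : nat).
Notation V := 'rV[F]_k.
Let q := #|F|.
Let N := #|{: V}|.
Hypothesis k_ge : (14 <= k)%N.

Let q_ge2 : (2 <= q)%N. Proof. exact: card_finNzRing_gt1. Qed.
Let NE : N = (q ^ k)%N. Proof. by rewrite /N card_mx mul1n. Qed.

(** Summing [card_pairs1] over nonzero [z] loses the factors (N - 1)/N and (N - q)/N. Both are at
    least 3/4 since N >= 4q, and 9/16 exceeds 1/2. *)
Lemma eq_dotp_dense :
  (N ^ 3 <= 2 * (q ^ 2 * boxcount (@eq_dotp F k) setT setT setT))%N.
Proof.
have N4q : (4 * q <= N)%N.
  apply: (@leq_trans (q ^ 3)); last by rewrite NE leq_pexp2l //; lia.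
  by rewrite (expnD q 2 1) expn1 leq_mul2r (leq_sqr 2) q_ge2 orbT.
have cntE : boxcount (@eq_dotp F k) setT setT setT = (\sum_(z : V) #|pairs1 z|)%N.
  rewrite /boxcount pair_big exchange_big /= (eq_bigl xpredT); last first.
    by move=> z; rewrite inE.
  apply: eq_bigr => z _; rewrite -sum1_card big_mkcond [RHS]big_mkcond /=.
  by apply: eq_bigr => -[x y] _; rewrite !inE /=; case: eq_dotp.
have lower : ((N - 1) * ((N - q) * N) <= q ^ 2 * boxcount (@eq_dotp F k) setT setT setT)%N.
  rewrite cntE big_distrr (bigID (fun z : V => z != 0)) /=.
  apply: leq_trans (leq_addr _ _).
  apply: (@leq_trans (\sum_(z : V | z != 0%R) (N - q) * N)%N).
    rewrite sum_nat_const leq_mul2r; apply/orP; right.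
    by rewrite (cardC1 (0 : V)) subn1.
  by apply: leq_sum => z z0; rewrite [leqRHS]mulnC; apply: card_pairs1.
have : (N ^ 3 <= 2 * ((N - 1) * ((N - q) * N)))%N.
  have e1 : (3 * N <= 4 * (N - 1))%N by lia.
  have e2 : (3 * N <= 4 * (N - q))%N by lia.
  have := leq_mul (leq_mul e1 e2) (leqnn N).
  have -> : (3 * N * (3 * N) * N = 9 * N ^ 3)%N by ring.
  have -> : (4 * (N - 1) * (4 * (N - q)) * N = 16 * ((N - 1) * ((N - q) * N)))%N by ring.
  by move: (N ^ 3)%N ((N - 1) * ((N - q) * N))%N => a b; lia.
move/leq_trans; apply; rewrite leq_mul2l; apply/orP; right; exact: lower.
Qed.

(** At cost 0 the witness is empty and the protocol constant, but the predicate holds at (0, 0, 0)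
    and fails at (e, e, 0) for a unit vector e. *)
Lemma nondet_neq0 : ~ nondet_within (@eq_dotp F k) 0.
Proof.
case=> m [P [Pc PD]].
have z0 : eq_dotp (0 : V) 0 0 by rewrite /eq_dotp !eqxx.
have k0 : (0 < k)%N by lia.
pose e : V := delta_mx 0 (Ordinal k0).
have /PD[w] := z0; have := Pc w; rewrite leqn0 addn_eq0 => /andP[_ Pw].
move: Pw (PD e e 0); case Ew : (P w) => [b| | |] // _ /= eD bT.
have /eD : exists w, nof_run (P w) e e 0 by exists w; rewrite Ew.
have e0 : dotp e 0 = 0 by rewrite /dotp big1 // => i _; rewrite [X in _ * X]mxE mulr0.
have ee : dotp e e = 1.
  rewrite /dotp (bigD1 (Ordinal k0)) //= big1 ?addr0 => [|i i0].
    by rewrite mxE !eqxx mulr1.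
  by rewrite mxE (negbTE i0) andbF mul0r.
by rewrite /eq_dotp e0 ee oner_eq0.
Qed.

Lemma nondet_lower (c : nat) : nondet_within (@eq_dotp F k) c -> (0 < c)%N ->
  (q < 2 ^ (2870 * c ^ 2))%N.
Proof.
move=> /nondet_cylinders[s sc sD] c0; rewrite ltnNge; apply/negP => q_big.
pose cnt (a : cylinder V V V) := boxcount (in_cylinder a) setT setT setT.
have cover : (boxcount (@eq_dotp F k) setT setT setT <= \sum_(a <- s) cnt a)%N.
  rewrite /cnt /boxcount [leqRHS]exchange_big /=; apply: leq_sum => x _.
  rewrite [leqRHS]exchange_big /=; apply: leq_sum => y _.
  rewrite [leqRHS]exchange_big /=; apply: leq_sum => z _.
  rewrite sD; elim: (s) => [|a s' IH]; first by rewrite big_nil.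
  by rewrite big_cons /=; case: (in_cylinder a x y z) => //=; rewrite add1n.
pose M := boxcount (@eq_dotp F k) setT setT setT.
have N_gt0 : (0 < N)%N by rewrite NE expn_gt0 (ltnW q_ge2).
have M_gt0 : (0 < M)%N.
  have : (0 < N ^ 3)%N by rewrite expn_gt0 N_gt0.
  by move/leq_trans/(_ eq_dotp_dense); rewrite !muln_gt0 => /and3P[].
pose a0 : cylinder V V V := (fun _ _ => true, fun _ _ => true, fun _ _ => true).
(* Pigeonhole: some cylinder intersection holds a fraction 2^-c of the ones. *)
have /(has_nthP a0)[i i_s] : has (fun a => M <= 2 ^ c * cnt a)%N s.
  apply/negPn; rewrite -all_predC; apply/negP => s_small.
  have : (2 ^ c * \sum_(a <- s) cnt a <= size s * M.-1)%N.
    elim: (s) s_small => [|a s' IH] /=; first by rewrite big_nil muln0.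
    move=> /andP[a_small /IH s_small]; rewrite big_cons mulnDr mulSn leq_add //.
    by rewrite -ltnS prednK // ltnNge.
  have := leq_mul sc (leqnn M.-1).
  move=> h1 /leq_trans/(_ h1); rewrite leq_pmul2l ?expn_gt0 //.
  by move=> h2; have := leq_trans cover h2; rewrite leqNgt prednK // leqnn.
set a := nth a0 s i => a_big.
(* The two extra bits in [h] pay for the factor 2 of [eq_dotp_dense] and the factor 2 in the density
   hypothesis; the 6 in [p] is due to 56 <= 2^6. *)
pose h := (c + 2)%N; pose p := (2 * h + 6)%N.
apply: (@no_large_cylinder F k h p _ _ _ _ _ _ a.1.1 a.1.2 a.2) => //.
- by rewrite /h; lia.
- by rewrite /p; lia.
- by rewrite /p oddD oddM.
- by rewrite /p -expnM expnD mulnC [(h * 2)%N]mulnC leq_mul2l orbT.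
- apply: leq_trans q_big.
  have -> : (2 * (2 ^ h) ^ 2 = 2 ^ (2 * h + 1))%N.
    by rewrite -expnM addn1 expnS mulnC [(h * 2)%N]mulnC mulnC.
  rewrite -expnM leq_pexp2l // /p /h.
  have : (c <= c ^ 2)%N by apply: leq_pmulr.
  (* This is the exponent of 2 in the threshold [S]. For c >= 1 it is at most (136 + 1024 + 1710)
     c^2 = 2870 c^2. *)
  have -> : ((2 * (c + 2) + 1) * (34 * (2 * (c + 2) + 6)).+2 =
    136 * c ^ 2 + 1024 * c + 1710)%N by ring.
  move: (c ^ 2)%N => c2; lia.
- move=> x y z inc; rewrite sD; apply/(has_nthP a0); by exists i.
have d := eq_dotp_dense; rewrite -/M in d.
have := leq_mul (leqnn (2 * q ^ 2)%N) a_big.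
have -> : (2 * q ^ 2 * M = 2 * (q ^ 2 * M))%N by ring.
move/(leq_trans d)/(leq_mul (leqnn 2)); move/leq_trans; apply.
rewrite -/(in_cylinder a) /h expnD -/(cnt a).
by apply: eq_leq; ring.
Qed.
End LowerBound.

(** * Randomized upper bound *)

Lemma card_flip (T : finType) (phi : T -> T) (Q E : pred T) :
  involutive phi -> (forall r, Q (phi r) = Q r) ->
  (forall r, E (phi r) = ~~ E r) ->
  (#|[set r | Q r && E r]| * 2 = #|[set r | Q r]|)%N.
Proof.
move=> phiK Qphi Ephi.
have eqC : #|[set r | Q r && ~~ E r]| = #|[set r | Q r && E r]|.
  rewrite -(card_imset _ (can_inj phiK)); congr #|pred_of_set _|.
  apply/setP => r; rewrite [RHS]inE; apply/imsetP/idP => [[r' + ->]|QE].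
    by rewrite inE Qphi Ephi.
  by exists (phi r); rewrite ?phiK // inE Qphi Ephi negbK.
rewrite muln2 -addnn -[X in (_ + X)%N]eqC -(cardsID [set r | E r] [set r | Q r]).
by congr addn; apply: eq_card => r; rewrite !inE // andbC.
Qed.

Section RandomHash.
Variables (F : finFieldType) (k : nat).
Notation V := 'rV[F]_k.
Let m := (#|F| + #|F|)%N.

(** The random string holds the value tables of two independent uniform functions from [F] to bits;
    [b] selects the table. *)
Definition hash (b : bool) (r : m.-tuple bool) (a : F) : bool :=
  tnth r (if b then lshift #|F| (enum_rank a) else rshift #|F| (enum_rank a)).

Fixpoint agree (hs : seq (F -> bool)) : nof_protocol V V V :=
  if hs is h :: hs' then
    Speak3 (fun x y => h (dotp x y))
      (Speak2 (fun x z => h (dotp x z))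
        (Speak1 (fun y z => h (dotp y z)) (agree hs') (Output V V V false))
        (Output V V V false))
      (Speak2 (fun x z => h (dotp x z)) (Output V V V false)
        (Speak1 (fun y z => h (dotp y z)) (Output V V V false) (agree hs')))
  else Output V V V true.

Lemma agree_cost hs : nof_cost (agree hs) = (3 * size hs)%N.
Proof. by elim: hs => //= h hs ->; lia. Qed.

Lemma agree_run hs x y z : nof_run (agree hs) x y z =
  all (fun h => (h (dotp x y) == h (dotp x z)) && (h (dotp x z) == h (dotp y z))) hs.
Proof.
elim: hs => //= h hs ->.
by case: (h (dotp x y)); case: (h (dotp x z)); case: (h (dotp y z)).
Qed.

Definition flip (i : 'I_m) (r : m.-tuple bool) : m.-tuple bool :=
  [tuple (if l == i then ~~ tnth r l else tnth r l) | l < m].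

Lemma flipK i : involutive (flip i).
Proof.
move=> r; apply: eq_from_tnth => l; rewrite !tnth_mktuple.
by case: eqP => //; rewrite negbK.
Qed.

(** Flipping the entry of [u] in one table toggles the collision in that table and leaves the other
    table alone, so each collision condition halves the number of strings. *)
Lemma card_collision (u v : F) : u != v ->
  (#|[set r | (hash true r u == hash true r v) &&
      (hash false r u == hash false r v)]| * 4 = #|{: m.-tuple bool}|)%N.
Proof.
move=> uv.
have vu : v != u by rewrite eq_sym.
have rk (a b : F) : (enum_rank a == enum_rank b) = (a == b).
  by apply: inj_eq; apply: enum_rank_inj.
pose i1 : 'I_m := lshift #|F| (enum_rank u).
pose i2 : 'I_m := rshift #|F| (enum_rank u).
have negb_eqbl (a b : bool) : (~~ a == b) = ~~ (a == b) by case: a; case: b.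
have := @card_flip _ (flip i2) (fun r => hash true r u == hash true r v)
  (fun r => hash false r u == hash false r v) (@flipK i2).
have := @card_flip _ (flip i1) predT (fun r => hash true r u == hash true r v) (@flipK i1).
move=> /(_ (fun=> erefl)) c1 c2.
rewrite (_ : 4 = 2 * 2)%N // mulnA c2.
- rewrite (_ : [set r | _] = [set r | predT r && (hash true r u == hash true r v)]).
    by rewrite c1 ?cardsE // => r; rewrite /hash !tnth_mktuple /i1 eqxx
      (inj_eq (@lshift_inj _ _)) rk (negbTE vu) negb_eqbl.
  by apply/setP => r; rewrite !inE.
- by move=> r; rewrite /hash !tnth_mktuple /i2 !eq_lrshift.
- move=> r; rewrite /hash !tnth_mktuple /i2 eqxx (inj_eq (@rshift_inj _ _)) rk.
  by rewrite (negbTE vu) negb_eqbl.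
Qed.

(** Each of the three scalar products is hashed by the player who sees both factors, for two hashes.
    Inputs in the predicate are always accepted; on others two distinct scalar products must collide
    under both hashes, an error of at most 1/4. *)
Lemma eq_dotp_rand : rand_within (@eq_dotp F k) 6.
Proof.
exists m, (fun r => agree [:: hash true r; hash false r]).
split=> [r|x y z]; first by rewrite agree_cost.
set good := [set r | _].
have M0 : (0 < #|{: m.-tuple bool}|)%N by rewrite card_tuple card_bool expn_gt0.
suff : (2 * #|{: m.-tuple bool}| <= 3 * #|good|)%N.
  rewrite -(ler_nat rat) !natrM => le.
  rewrite ler_pdivlMr ?ltr0n // mulrAC ler_pdivrMr //.
  by rewrite [leRHS]mulrC.
case D : (eq_dotp x y z).
  rewrite (_ : good = setT); first by rewrite cardsT leq_mul2r orbT.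
  apply/setP => r; rewrite !inE agree_run D /=.
  by move: D => /andP[/eqP -> /eqP ->]; rewrite !eqxx.
have [u [v [uv incl]]] : exists u v : F, u != v /\
    forall r, r \notin good -> (hash true r u == hash true r v) &&
      (hash false r u == hash false r v).
  have [e1|e1] := eqVneq (dotp x y) (dotp x z).
    exists (dotp x z), (dotp y z); split.
      by move: D; rewrite /eq_dotp e1 eqxx /= => /negbT.
    move=> r; rewrite inE agree_run D /= eqbF_neg negbK andbT.
    by move=> /andP[/andP[_ ->] /andP[_ ->]].
  exists (dotp x y), (dotp x z); split=> // r.
  rewrite inE agree_run D /= eqbF_neg negbK andbT.
  by move=> /andP[/andP[-> _] /andP[-> _]].
have := card_collision uv; have := cardsC good.
set coll := [set r | _ && _].
have : (#|~: good| <= #|coll|)%N.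
  by apply: subset_leq_card; apply/subsetP => r; rewrite in_setC => /incl h; rewrite inE.
by move: #|good| #|~: good| #|coll| #|{: m.-tuple bool}| => g g' c M; lia.
Qed.

End RandomHash.

(** Taking logarithms gives log2 (q^k) <= K c^2 with K = 2870k. As K >= 1, dividing by K instead of
    its square root is harmless. *)
Lemma sqrt_log2_bound (R : realType) (k q c : nat) : (0 < k)%N -> (0 < q)%N ->
  (q < 2 ^ (2870 * c ^ 2))%N ->
  (2870 * k)%:R^-1 * (log2 ((q ^ k)%:R : R)) `^ 2^-1 <= c%:R.
Proof.
move=> k0 q0 qc.
pose K : R := (2870 * k)%:R.
have K1 : 1 <= K by rewrite ler1n muln_gt0.
have K0 : 0 < K by apply: lt_le_trans K1.
have ln2 : 0 < ln (2 : R) by rewrite ln_gt0 // ltr1n.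
rewrite mulrC ler_pdivrMr // -/K.
have logE : log2 ((q ^ k)%:R : R) <= K * c%:R ^+ 2.
  rewrite /log2 ler_pdivrMr // natrX lnXn ?ltr0n //.
  have : ln (q%:R : R) <= ln ((2 : R) ^+ (2870 * c ^ 2)).
    rewrite ler_ln ?posrE ?ltr0n ?exprn_gt0 //.
    by rewrite -natrX ler_nat ltnW.
  rewrite lnXn // => le.
  rewrite -[ln _ *+ k]mulr_natl.
  apply: le_trans (ler_wpM2l (ler0n _ _) le) _.
  rewrite -[ln _ *+ _]mulr_natl /K !natrM.
  by apply: eq_ler; ring.
rewrite powR12_sqrt; last first.
  by rewrite /log2 divr_ge0 ?(ltW ln2) // ln_ge0 // ler1n expn_gt0 q0.
have -> : c%:R * K = Num.sqrt ((c%:R * K) ^+ 2).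
  by rewrite sqrtr_sqr ger0_norm // mulr_ge0 // ltW.
rewrite ler_sqrt; last by rewrite exprn_ge0 // mulr_ge0 // ltW.
apply: le_trans logE _; rewrite exprMn mulrC ler_wpM2l ?exprn_ge0 //.
by rewrite expr2 ler_peMl // ltW.
Qed.

Unset Implicit Arguments.

Theorem theorem1p3 (R : realType) :
  exists k0 : nat, forall k : nat, (k0 <= k)%N ->
  exists (C : nat) (c : R), 0 < c /\
    forall (q : nat) (F : finFieldType), prime_power q -> #|F| = q ->
    let N := (q ^ k)%N in
    [/\ (rand_cc (@eq_dotp F k) <= C)%N,
        c * (log2 (N%:R : R)) `^ 2^-1 <= (det_cc (@eq_dotp F k))%:R
      & c * (log2 (N%:R : R)) `^ 2^-1 <= (nondet_cc (@eq_dotp F k))%:R].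
Proof.
exists 14%N => k k_ge; exists 6%N, (2870 * k)%:R^-1.
have k0 : (0 < k)%N by exact: leq_trans k_ge.
split; first by rewrite invr_gt0 ltr0n muln_gt0.
move=> q F _ Fq N.
have bound c : nondet_within (@eq_dotp F k) c ->
    (2870 * k)%:R^-1 * (log2 (N%:R : R)) `^ 2^-1 <= c%:R.
  (* Cost 0 is excluded separately, as [nondet_lower] assumes a positive cost. *)
  have [->|c_gt0] := posnP c; first by move/(nondet_neq0 k_ge).
  move=> nd; have := nondet_lower k_ge nd c_gt0; rewrite Fq => qc.
  apply: sqrt_log2_bound => //; rewrite -Fq; exact: ltnW (card_finNzRing_gt1 F).
split.
- rewrite /rand_cc; case: ex_minnP => c _; apply.
  exact/asboolP/eq_dotp_rand.
- rewrite /det_cc; case: ex_minnP => c /asboolP /det_nondet nd _; exact: bound.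
- rewrite /nondet_cc; case: ex_minnP => c /asboolP nd _; exact: bound.
Qed.
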